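(* Let $G$ be a finite connected $r$-regular non-bipartite graph, directed or not, with vertices $1,\dots,k$, let $T$ be a compact topological group, and let $t_1,\dots,t_k\in T$, with $t_i$ attached to the $i$-th vertex of $G$. Suppose that the closed subgroup generated by $t_1,\dots,t_k$ is equal to $T$, and that the elements $t_1,\dots,t_k$ do not all lie in the same coset with respect to a one-dimensional representation of $T$ (that is, for no non-trivial one-dimensional unitary representation $\rho$ of $T$ do they all lie in the same coset of $\ker\rho$). For each closed walk $c=(w_1,\dots,w_N)$ of length $N$ on $G$ put $t_c=t_{w_N}\cdots t_{w_1}\in T$. Then, as $c$ ranges over the set $W_N$ of all closed walks of length $N$ on $G$, the elements $t_c$ become equidistributed in $T$ with respect to Haar measure as $N\to\infty$; that is, for every continuous function $F:T\to\mathbf C$, $$\lim_{N\to\infty}\frac1{|W_N|}\sum_{c\in W_N}F(t_c)=\int_TF\,d\mu,$$ where $\mu$ is the normalized Haar measure on $T$.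
   Context: Graphs may have self-loops and multiple edges. Closed walks have a basepoint and are counted with edge multiplicity, so $|W_N|=\operatorname{tr}A(G)^N$, where $A(G)$ is the adjacency matrix, whose $ij$ entry is the number of edges from the $i$-th to the $j$-th vertex. $r$-regular means that all row and column sums of $A(G)$ equal $r$. Representations are continuous.
   Formalization: For directed graphs (non-symmetric adjacency matrix), non-bipartite is taken to mean that the bipartite double cover is connected; having no 2-colouring, or even being aperiodic, does not suffice, e.g. a directed 3-cycle with T trivial is a counterexample. The undirected case is literal. *)

(* Defs.v *)
From HB Require Import structures.
From mathcomp Require Import all_boot all_order all_algebra.
From mathcomp Require Import all_classical all_reals all_analysis.
From mathcomp Require Import complex.
Set Implicit Arguments.
Unset Strict Implicit.
Unset Printing Implicit Defensive.
Import Order.TTheory GRing.Theory Num.Theory.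
Import numFieldNormedType.Exports.

Local Open Scope classical_set_scope.
Local Open Scope ring_scope.

(* Loops and multiple edges are allowed.  An undirected graph is represented by
   its directed edges, so that its adjacency matrix is symmetric. *)
Record multigraph (k : nat) := Multigraph {
  edge : finType;
  source : edge -> 'I_k;
  target : edge -> 'I_k
}.

Section Graphs.
Local Open Scope nat_scope.
Variables (k : nat) (G : multigraph k).

Definition adjacency : 'M[nat]_k :=
  \matrix_(i, j) #|[pred e : edge G | (source e == i) && (target e == j)]|.

Definition adjacent : rel 'I_k := [rel i j | 0 < adjacency i j].

Definition undirected : bool := (adjacency^T == adjacency)%R.

Definition graph_regular (r : nat) : Prop :=
  (forall i, \sum_j adjacency i j = r) /\ (forall j, \sum_i adjacency i j = r).

(* Strong connectedness; for a regular digraph (in-degrees equal out-degrees)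
   this is the same as connectedness of the underlying undirected graph. *)
Definition graph_connected : Prop := 0 < k /\ forall i j, connect adjacent i j.

Definition bipartite : Prop :=
  exists c : 'I_k -> bool, forall i j, adjacent i j -> c i != c j.

Definition double_cover : rel ('I_k + 'I_k) := fun x y =>
  match x, y with
  | inl i, inr j | inr j, inl i => adjacent i j
  | _, _ => false
  end.

(* A connected undirected graph is non-bipartite iff its bipartite double cover
   is connected, and the latter is the notion used for digraphs.  For
   them neither the absence of a proper 2-colouring nor aperiodicity suffices
   for equidistribution: let (a, b), with a, b in {0, 1}, be the vertices, with
   an edge from (a, b) to (c, a) for all a, b, c; this digraph is 2-regular,
   strongly connected and has loops.  Let T be the group of signed 2 x 2
   permutation matrices, and let t_(a, b) be such a matrix mapping the basis
   vector e_b to e_a: t_(0,0) = diag(1, -1), t_(1,1) = diag(-1, 1),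
   t_(0,1) = [0 1; 1 0], t_(1,0) = [0 -1; 1 0].  These generate T, and no
   nontrivial character of T is constant on them, but t_c fixes a basis vector
   for every closed walk c, so that t_c is never equal to -1. *)
Definition nonbipartite : Prop :=
  if undirected then ~ bipartite else forall x y, connect double_cover x y.

(* A walk is given by its edges; its n-th vertex is the source of the n-th edge,
   so that the basepoint is the source of the first edge.  *)
Definition closed_walks (N : nat) : {set N.-tuple (edge G)} :=
  [set c : N.-tuple (edge G) | cycle [rel e f | target e == source f] c].

Definition walk_vertices (c : seq (edge G)) : seq 'I_k :=
  [seq source e | e <- c].

End Graphs.

(* The bundling gives R[i] the topology of numeric fields. *)
Definition C (R : realType) : numClosedFieldType := R[i].

HB.mixin Record isTopologicalGroup T & Topological T & Group T := {
  mulg_continuous : continuous (fun x : T * T => (x.1 * x.2)%g);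
  invg_continuous : continuous (fun x : T => x^-1%g)
}.

(* The base point plays no role: measurable types have to be pointed. *)
#[short(type="topologicalGroupType")]
HB.structure Definition TopologicalGroup :=
  {T of PointedTopological T & Group T & isTopologicalGroup T}.

Section Groups.
Variable T : topologicalGroupType.
Implicit Types (A H : set T).

Definition subgroup H : Prop :=
  [/\ H 1%g, forall x y, H x -> H y -> H (x * y)%g
    & forall x, H x -> H x^-1%g].

Definition closed_subgroup_generated A : set T :=
  \bigcap_(H in [set H | [/\ closed H, subgroup H & A `<=` H]]) H.

Definition walk_product k (G : multigraph k) (t : 'I_k -> T)
    (c : seq (edge G)) : T :=
  foldl (fun g w => (t w * g)%g) 1%g (walk_vertices c).

Definition borel := g_sigma_algebraType (@open T).

Variable R : realType.

Definition haar (mu : probability borel R) : Prop :=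
  (forall (g : T) (A : set borel), measurable A ->
     mu [set (g * x)%g | x in A] = mu A) /\
  (forall A : set borel, measurable A ->
     mu A = ereal_inf [set mu U | U in [set U : set T | open U /\ A `<=` U]]).

(* One-dimensional unitary representations, as maps to the unit circle. *)
Definition unitary_character (rho : T -> C R) : Prop :=
  [/\ continuous rho, forall x y, rho (x * y)%g = rho x * rho y
    & forall x, `|rho x| = 1].

Definition character_kernel (rho : T -> C R) : set T :=
  [set x | rho x = 1].

Definition in_one_coset (A H : set T) : Prop :=
  exists g : T, A `<=` [set (g * h)%g | h in H].

Definition integral_complex (mu : probability borel R) (F : T -> C R) : C R :=
  Complex (\int[mu]_x complex.Re (F x))%R (\int[mu]_x complex.Im (F x))%R.

End Groups.

(* Main.v *)
Require Import Defs.
From mathcomp Require Import all_boot all_order all_algebra.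
From mathcomp Require Import all_classical all_reals all_analysis.
From mathcomp Require Import complex measurable_realfun cyclic separable cyclotomic.
From mathcomp Require Import finmap zify ring.
Set Implicit Arguments.
Unset Strict Implicit.
Unset Printing Implicit Defensive.
Import Order.TTheory GRing.Theory Num.Theory.
Import numFieldNormedType.Exports.

Local Open Scope classical_set_scope.
Local Open Scope ring_scope.

(* The operator [P f i g = r^-1 * sum of f (target e) (t_i g) over the edges e
   out of i] on k-tuples of continuous functions on T has the weighted sums over
   walks as iterates, and it is a contraction for the sup norm and for the
   L2 norm.  By equicontinuity the iterates [P^N f] of a tuple of total integral
   zero have uniform limits h along ultrafilters, and [P^n h] has the same L2
   norm for all n.  Equality in the convexity inequality and connectedness of the
   double cover make [P^n h] independent of the vertex, so that P acts on h as
   left translation by any of the t_i.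

   If h is nonzero, Wiener's argument (Parseval for the Fejer means of the
   almost periodic sequence <t^n h, h>, over roots of unity) shows that some
   means [n^-1 * sum of l^a (h translated by t^a)] with |l| = 1 stay bounded away
   from zero; a limit of them is an eigenfunction psi of the translation by every
   t_i, with a common eigenvalue.  Then [g |-> psi (g x) / psi x] is a character
   of T which is constant on the t_i, hence trivial, so psi is constant; having
   integral zero, it vanishes, a contradiction.  Thus h = 0. *)

(** * Limits along ultrafilters *)

Lemma cvg_sum_seq (V : numFieldType) (I J : Type)
    (F : set_system I) (FF : Filter F) (s : seq J) (P : pred J) (f : J -> I -> V) (l : J -> V) :
  (forall j, P j -> f j @ F --> l j) ->
  (fun x => \sum_(j <- s | P j) f j x) @ F --> \sum_(j <- s | P j) l j.
Proof.
by move=> fl; apply: cvg_big => //; exact: add_continuous.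
Qed.

Lemma ultra_fmap (I J : Type) (f : I -> J) (U : set_system I) :
  UltraFilter U -> UltraFilter (f @ U).
Proof.
move=> UU; split; first exact: fmap_proper_filter.
move=> G GF sG; rewrite eqEsubset; split=> // A GA.
have [//|UnA] := in_ultra_setVsetC (f @^-1` A) UU.
have GnA : G (~` A) by apply: sG.
by have [x []] := filter_ex (filterI GA GnA).
Qed.

Lemma sqrt_sum_sqr_le (F : rcfType) (a b : F) :
  Num.sqrt (a ^+ 2 + b ^+ 2) <= `|a| + `|b|.
Proof.
have h : 0 <= `|a| + `|b| by rewrite addr_ge0.
rewrite -[leRHS](ger0_norm h) -[leRHS]sqrtr_sqr ler_wsqrtr // sqrrD !real_normK ?num_real //.
by rewrite lerD2r lerDl mulrn_wge0 // mulr_ge0.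
Qed.

Lemma le_sqrt_sum_sqr (F : rcfType) (a b : F) : `|a| <= Num.sqrt (a ^+ 2 + b ^+ 2).
Proof. by rewrite -[leLHS]sqrtr_sqr ler_wsqrtr // lerDl sqr_ge0. Qed.

Section ComplexNumbers.
Variable R : realType.
Implicit Types (z l : C R).

Lemma normC_le_ReIm z : `|z| <= (`|complex.Re z| + `|complex.Im z|)%:C%C.
Proof. by rewrite normc_def lecR sqrt_sum_sqr_le. Qed.

Lemma normC_ge_Im z : `|complex.Im z|%:C%C <= `|z|.
Proof. by rewrite normc_def lecR addrC le_sqrt_sum_sqr. Qed.

Lemma posC_real z : 0 < z -> exists2 e : R, 0 < e & z = e%:C%C.
Proof.
case: z => a b; rewrite ltcE /= => /andP[/eqP -> a0]; by exists a.
Qed.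

Lemma archiC (x : C R) : exists n : nat, `|x| <= n%:R.
Proof.
case: x => a b; rewrite normc_def.
exists (Num.bound (Num.sqrt (a ^+ 2 + b ^+ 2))).
rewrite -[_%:R](rmorph_nat (real_complex R)) lecR ltW //.
by apply: archi_boundP; rewrite sqrtr_ge0.
Qed.

Lemma cvgC_ReIm (I : Type) (F : set_system I) (FF : Filter F) (u : I -> C R) l :
  (fun i => complex.Re (u i)) @ F --> complex.Re l ->
  (fun i => complex.Im (u i)) @ F --> complex.Im l -> u @ F --> l.
Proof.
move=> /cvgrPdist_lt hr /cvgrPdist_lt hi; apply/cvgrPdist_lt => e /posC_real[d d0 ->].
have d2 : 0 < d / 2 by rewrite divr_gt0.
near=> i.
apply: le_lt_trans (normC_le_ReIm _) _; rewrite ltcR [d]splitr ltrD //.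
  rewrite raddfB /=; near: i; exact: hr.
rewrite raddfB /=; near: i; exact: hi.
Unshelve. all: by end_near. Qed.

Lemma cvgC_Re (I : Type) (F : set_system I) (FF : Filter F) (u : I -> C R) l :
  u @ F --> l -> (fun i => complex.Re (u i)) @ F --> complex.Re l.
Proof.
move=> /cvgrPdist_lt h; apply/cvgrPdist_lt => e e0.
have e0' : 0 < e%:C%C :> C R by rewrite ltcR.
apply: filterS (h _ e0') => i hi; rewrite -ltcR -raddfB.
exact: le_lt_trans (normc_ge_Re _) hi.
Qed.

Lemma cvgC_Im (I : Type) (F : set_system I) (FF : Filter F) (u : I -> C R) l :
  u @ F --> l -> (fun i => complex.Im (u i)) @ F --> complex.Im l.
Proof.
move=> /cvgrPdist_lt h; apply/cvgrPdist_lt => e e0.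
have e0' : 0 < e%:C%C :> C R by rewrite ltcR.
apply: filterS (h _ e0') => i hi; rewrite -ltcR -raddfB.
exact: le_lt_trans (normC_ge_Im _) hi.
Qed.

Lemma ultra_cvgR (I : Type) (U : set_system I) (u : I -> R) (M : R) :
  UltraFilter U -> (forall i, `|u i| <= M) -> exists l : R, u @ U --> l.
Proof.
move=> UU uM; have := @segment_compact R (- M) M; rewrite compact_ultra.
move=> /(_ (u @ U) (ultra_fmap u UU)) [].
  by apply: (@filterE _ U) => i; rewrite /= in_itv /= -ler_norml uM.
by move=> l [_ ul]; exists l.
Qed.

Lemma ultra_cvgC (I : Type) (U : set_system I) (u : I -> C R) (M : C R) :
  UltraFilter U -> (forall i, `|u i| <= M) -> exists l : C R, u @ U --> l.
Proof.
move=> UU uM.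
have bRe i : `|complex.Re (u i)| <= complex.Re M.
  have := le_trans (normc_ge_Re (u i)) (uM i).
  by case: (M) => a b; rewrite lecE /= => /andP[].
have bIm i : `|complex.Im (u i)| <= complex.Re M.
  have := le_trans (normC_ge_Im (u i)) (uM i).
  by case: (M) => a b; rewrite lecE /= => /andP[].
have [a ha] := ultra_cvgR UU bRe; have [b hb] := ultra_cvgR UU bIm.
by exists (Complex a b); apply: cvgC_ReIm.
Qed.

(** If [u] failed to be within [e] of [l] infinitely often, the trace of [\oo] on those indices
    would be a proper filter, and an ultrafilter refining it would contradict the hypothesis. *)
Lemma ultra_cvgP (K : numFieldType) (u : nat -> K) (l : K) :
  (forall U : set_system nat, UltraFilter U -> \oo `<=` U -> u @ U --> l) ->
  u @ \oo --> l.
Proof.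
move=> h; apply: contrapT => /cvgrPdist_lt hn.
have [e e0 He] : exists2 e : K, 0 < e & ~ \forall n \near \oo, `|l - u n| < e.
  apply: contrapT => hne; apply: hn => e e0.
  by apply: contrapT => he; apply: hne; exists e.
pose B := [set n | ~ `|l - u n| < e].
have PF : ProperFilter (within B \oo).
  apply: Build_ProperFilter_ex.
  move=> P PB; apply: contrapT => Pn; apply: He.
  have PB' : \oo [set n | B n -> P n] by exact: PB.
  apply: filterS PB' => n hn'; apply: contrapT => hB; apply: Pn; exists n; exact: hn'.
have [U [UU sU]] := ultraFilterLemma PF.
have /cvgrPdist_lt /(_ e e0) hU : u @ U --> l.
  by apply: h => // A A0; apply: sU; apply: (@filterS _ \oo _ _ _ _ A0) => n An _.
have UB : U B by apply: sU; apply: (@filterE _ \oo).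
by have [n [h1 h2]] := filter_ex (filterI UB hU); exact: h1.
Qed.

Lemma cvg_norm_le (I : Type) (U : set_system I) (UU : ProperFilter U) (u : I -> C R)
    (l M : C R) :
  u @ U --> l -> (\forall i \near U, `|u i| <= M) -> `|l| <= M.
Proof.
move=> ul uM; have [i0 hi0] := filter_ex uM.
have M0 := le_trans (normr_ge0 _) hi0.
apply/ler_addgt0Pr => e e0; have /cvgrPdist_lt /(_ e e0) h := ul.
have [i [hi1 hi2]] := filter_ex (filterI h uM).
rewrite -[l](subrK (u i)) addrC (le_trans (ler_normD _ _)) // addrC.
rewrite -[l - u i]opprK normrN opprB addrC lerD // distrC; exact: ltW.
Qed.

End ComplexNumbers.

(** * Equicontinuous families on a compact group *)

Section CompactGroup.
Variables (R : realType) (T : topologicalGroupType).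
Hypothesis cT : compact [set: T].
Implicit Types (f : T -> C R) (W : C R -> set T) (M : C R).

Lemma cvg_mulg (I : Type) (F : set_system I) (FF : Filter F) (u v : I -> T) (x y : T) :
  u @ F --> x -> v @ F --> y -> (fun i => (u i * v i)%g) @ F --> (x * y)%g.
Proof.
move=> ux vy; apply: (@cvg_comp _ _ _ (fun i => (u i, v i)) (fun p : T * T => (p.1 * p.2)%g)).
  exact: cvg_pair ux vy.
exact: (@mulg_continuous T (x, y)).
Qed.

Lemma continuous_mulgl (t : T) : continuous (fun g : T => (t * g)%g).
Proof. by move=> g; apply: cvg_mulg; [exact: cvg_cst|exact: cvg_id]. Qed.

Lemma near_mulVg (g : T) (A : set T) : nbhs (1%g : T) A -> \forall y \near g, A (g^-1 * y)%g.
Proof.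
move=> A1; have : (fun y => (g^-1 * y)%g) @ g --> (g^-1 * g)%g.
  exact: (@continuous_mulgl g^-1%g g).
by rewrite mulVg => /(_ _ A1).
Qed.

Lemma continuous_comp_mulgl (S : topologicalType) (f : T -> S) (t : T) :
  continuous f -> continuous (fun g => f (t * g)%g).
Proof. by move=> cf g; apply: continuous_comp; [exact: continuous_mulgl|exact: cf]. Qed.

(** Compactness in its near-covering form: joint continuity of [f (g v) - f g] at each point
    [(g, 1)] gives estimates local in [g], which a compact group makes uniform. *)
Lemma right_uniform f (e : C R) : continuous f -> 0 < e ->
  \forall v \near (1%g : T), forall g, `|f (g * v)%g - f g| < e.
Proof.
move=> cf e0.
have [near_cov _] := compact_near_coveringP [set: T].
have X := near_cov cT T (nbhs 1%g) (fun v g => `|f (g * v)%g - f g| < e) _.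
suff H : forall g : T, \forall g' \near g & v \near (1%g : T), `|f (g' * v)%g - f g'| < e.
  by apply: filterS (X _ (fun g _ => H g)) => v hv g; exact: hv.
move=> g.
have : (fun p : T * T => f (p.1 * p.2)%g - f p.1) @ (nbhs g, nbhs 1%g) --> f (g * 1)%g - f g.
  apply: cvgB.
    apply: (@cvg_comp _ _ _ (fun p : T * T => (p.1 * p.2)%g) f).
      by apply: cvg_mulg; [exact: cvg_fst|exact: cvg_snd].
    exact: cf.
  apply: (@cvg_comp _ _ _ (fun p : T * T => p.1) f); last exact: cf.
  exact: cvg_fst.
rewrite mulg1 subrr => /cvgrPdist_lt /(_ e e0); apply: filterS => p.
by rewrite sub0r normrN.
Qed.

Lemma left_uniform f (e : C R) (s : T) : continuous f -> 0 < e ->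
  \forall s' \near s, forall g, `|f (s' * g)%g - f (s * g)%g| < e.
Proof.
move=> cf e0.
have [near_cov _] := compact_near_coveringP [set: T].
have X := near_cov cT T (nbhs s) (fun v g => `|f (v * g)%g - f (s * g)%g| < e) _.
suff H : forall g : T, \forall g' \near g & v \near s, `|f (v * g')%g - f (s * g')%g| < e.
  by apply: filterS (X _ (fun g _ => H g)) => v hv g; exact: hv.
move=> g.
have : (fun p : T * T => f (p.2 * p.1)%g - f (s * p.1)%g) @ (nbhs g, nbhs s)
    --> f (s * g)%g - f (s * g)%g.
  apply: cvgB.
    apply: (@cvg_comp _ _ _ (fun p : T * T => (p.2 * p.1)%g) f).
      by apply: cvg_mulg; [exact: cvg_snd|exact: cvg_fst].
    exact: cf.
  apply: (@cvg_comp _ _ _ (fun p : T * T => (s * p.1)%g) f); last exact: cf.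
  by apply: cvg_mulg; [exact: cvg_cst|exact: cvg_fst].
rewrite subrr => /cvgrPdist_lt /(_ e e0); apply: filterS => p.
by rewrite sub0r normrN.
Qed.

Lemma continuous_bounded f : continuous f -> exists2 M : C R, 0 <= M & forall g, `|f g| <= M.
Proof.
move=> cf.
have [near_cov _] := compact_near_coveringP [set: T].
have X := near_cov cT nat \oo (fun n g => `|f g| <= n%:R) _.
suff H : forall g : T, \forall g' \near g & n \near \oo, `|f g'| <= n%:R :> C R.
  have [n hn] := filter_ex (X _ (fun g _ => H g)).
  by exists n%:R => // g; exact: hn.
move=> g; have /cvgrPdist_lt /(_ 1 ltr01) h := cf g.
have [n hn] := archiC (`|f g| + 1); rewrite ger0_norm ?addr_ge0 // in hn.
exists ([set g' | `|f g - f g'| < 1], [set m | (n <= m)%N]) => /=.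
  by split => //; exists n.
move=> [g' m] /= [h1 h2]; rewrite -[f g'](subrK (f g)).
apply: le_trans (ler_normD _ _) _; apply: le_trans (le_trans _ hn) _.
  by rewrite addrC lerD2l distrC ltW.
by rewrite ler_nat.
Qed.

(* A modulus for right translations is preserved by left translations. *)
Definition kfam M W f := (forall g, `|f g| <= M) /\
  (forall e g v, 0 < e -> W e v -> `|f (g * v)%g - f g| <= e).

Definition modulus W := forall e : C R, 0 < e -> nbhs (1%g : T) (W e).

Lemma kfam_finite (J : finType) (f : J -> T -> C R) : (forall j, continuous (f j)) ->
  exists M W, [/\ 0 <= M, modulus W & forall j, kfam M W (f j)].
Proof.
move=> cf.
have /boolp.choice[m hm] : forall j, exists M : C R, 0 <= M /\ forall g, `|f j g| <= M.
  by move=> j; have [M M0 h] := continuous_bounded (cf j); exists M.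
exists (\sum_j m j), (fun e => [set v | forall j g, `|f j (g * v)%g - f j g| <= e]); split.
- by apply: sumr_ge0 => j _; have [] := hm j.
- move=> e e0; apply: filter_forall => j.
  by apply: filterS (right_uniform (cf j) e0) => v hv g; exact: ltW.
- move=> j; split; last by move=> e g v _ hv; exact: hv.
  move=> g; rewrite (bigD1 j) //= (le_trans (proj2 (hm j) g)) // lerDl.
  by apply: sumr_ge0 => i _; have [] := hm i.
Qed.

Lemma kfam_continuous M W f : modulus W -> kfam M W f -> continuous f.
Proof.
move=> mW [_ Wf] g; apply/cvgrPdist_lt => e e0.
have e2 : 0 < e / 2 by rewrite divr_gt0.
apply: filterS (near_mulVg g (mW _ e2)) => y hy.
rewrite -[y](mulVKg g) distrC; apply: le_lt_trans (Wf _ g _ e2 hy) _.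
by rewrite gtr_pMr // invf_lt1 ?ltr1n.
Qed.

Lemma kfam_translate M W f t : kfam M W f -> kfam M W (fun g => f (t * g)%g).
Proof. by move=> [bf Wf]; split=> [g|e g v e0 hv]; [exact: bf|rewrite mulgA; exact: Wf]. Qed.

(** Averaging costs neither the bound nor the modulus, so means of translates and iterates of the
    walk operator all stay in one equicontinuous family. *)
Lemma kfam_sum (J : finType) (P : pred J) (c : J -> C R) (f : J -> T -> C R) M W :
  0 <= M -> (forall j, P j -> kfam M W (f j)) -> \sum_(j | P j) `|c j| <= 1 ->
  kfam M W (fun g => \sum_(j | P j) c j * f j g).
Proof.
move=> M0 kf c1.
have bnd (x : J -> C R) e : 0 <= e -> (forall j, P j -> `|x j| <= e) ->
    `|\sum_(j | P j) c j * x j| <= e.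
  move=> e0 xe; apply: le_trans (ler_norm_sum _ _ _) _.
  apply: (@le_trans _ _ ((\sum_(j | P j) `|c j|) * e)); last by rewrite ler_piMl.
  by rewrite mulr_suml ler_sum // => j Pj; rewrite normrM ler_wpM2l // xe.
split=> [g|e g v e0 hv]; first by apply: bnd => // j /kf [].
rewrite -sumrB; under eq_bigr do rewrite -mulrBr.
by apply: bnd => [|j /kf [_]]; [exact: ltW|exact].
Qed.

(** Arzela-Ascoli along an ultrafilter: bounded values have pointwise limits, the limit inherits
    bound and modulus, and a three-epsilon argument with near-covering compactness makes the
    convergence uniform. *)
Lemma kfam_ultralimit (I : Type) (U : set_system I) (f : I -> T -> C R) M W :
  UltraFilter U -> modulus W -> (forall i, kfam M W (f i)) ->
  exists h, kfam M W h /\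
    forall e : C R, 0 < e -> \forall i \near U, forall g, `|h g - f i g| < e.
Proof.
move=> UU mW kf.
have /boolp.choice[h hh] : forall g, exists l : C R, (fun i => f i g) @ U --> l.
  by move=> g; apply: (ultra_cvgC (M := M)) => i; have [] := kf i.
have kh : kfam M W h.
  split=> [g|e g v e0 hv]; first by apply: cvg_norm_le (hh g) _; apply: nearW => i; have [] := kf i.
  apply: cvg_norm_le (cvgB (hh _) (hh _)) _.
  by apply: nearW => i; have [_ ] := kf i; apply.
exists h; split=> // e e0.
have [near_cov _] := compact_near_coveringP [set: T].
have X := near_cov cT I U (fun i g => `|h g - f i g| < e) _.
suff H : forall g : T, \forall g' \near g & i \near U, `|h g' - f i g'| < e.
  by apply: filterS (X _ (fun g _ => H g)) => i hi g; exact: hi.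
move=> g; have e3 : 0 < e / 3 by rewrite divr_gt0.
have /cvgrPdist_lt /(_ _ e3) h1 := kfam_continuous mW kh (x := g).
have /cvgrPdist_lt /(_ _ e3) h2 := hh g.
have h3 : \forall g' \near g, forall i, `|f i g' - f i g| <= e / 3.
  apply: filterS (near_mulVg g (mW _ e3)) => y hy i.
  by have [_ Wf] := kf i; rewrite -[y](mulVKg g); exact: Wf.
exists ([set y | `|h g - h y| < e / 3 /\ forall i, `|f i y - f i g| <= e / 3],
        [set i | `|h g - f i g| < e / 3]) => /=.
  by split=> //; exact: filterI.
move=> [y i] /= [[a1 a2] a3].
have -> : h y - f i y = - (h g - h y) + (h g - f i g) - (f i y - f i g).
  by rewrite opprB !addrA subrK opprB [RHS]addrC addrA addrC !addrA; ring.
have -> : e = e / 3 + e / 3 + e / 3 by field.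
apply: le_lt_trans (ler_normB _ _) _; apply: ltr_leD => //.
by apply: le_lt_trans (ler_normD _ _) _; rewrite normrN ltrD.
Qed.

(** The left translates of [f] are totally bounded for the sup norm: the colour of [s] names a
    member of a finite net within [e / 2] of the translate by [s]. *)
Lemma finite_coloring f (e : C R) : continuous f -> 0 < e ->
  exists (d : nat) (col : T -> 'I_d), forall s s', col s = col s' ->
    forall g, `|f (s * g)%g - f (s' * g)%g| <= e.
Proof.
move=> cf e0; have e2 : 0 < e / 2 by rewrite divr_gt0.
pose V s := [set s' | forall g, `|f (s' * g)%g - f (s * g)%g| < e / 2].
have := cT; rewrite compact_cover => /(_ T setT (fun s => (V s)^°)) [].
- by move=> s _; exact: open_interior.
- by move=> s _; exists s => //; rewrite /interior; exact: left_uniform.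
move=> D _ cov.
have /boolp.choice[c hc] : forall s, exists i : 'I_(size (enum_fset D)),
    V (nth 1%g (enum_fset D) i) s.
  move=> s; have [s' Ds' /interior_subset hs'] := cov s Logic.I.
  have lt : (index s' (enum_fset D) < size (enum_fset D))%N by rewrite index_mem.
  by exists (Ordinal lt); rewrite /= nth_index.
exists _, c => s s' css' g.
rewrite -(subrK (f (nth 1%g (enum_fset D) (c s) * g)%g) (f (s * g)%g)) -addrA.
apply: le_trans (ler_normD _ _) _; rewrite [e]splitr lerD //; first exact: ltW (hc s g).
by rewrite distrC css'; exact: ltW (hc s' g).
Qed.

End CompactGroup.

(** * Haar integral of continuous functions *)

Section HaarIntegral.
Variables (R : realType) (T : topologicalGroupType) (mu : probability (borel T) R).
Hypothesis cT : compact [set: T].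
Hypothesis hmu : haar mu.

Local Notation RI f := (\int[mu]_x f x)%R.

Lemma continuous_measurable_borel (f : T -> R) : continuous f ->
  measurable_fun [set: borel T] (f : borel T -> R).
Proof.
move=> /continuousP cf; apply: (measurability _ (RGenOpens.measurableE R)).
move=> _ [_ [a [b ->] <-]]; rewrite setTI; apply: sub_sigma_algebra.
exact/cf/interval_open.
Qed.

Lemma real_continuous_bounded (f : T -> R) : continuous f -> exists M : R, forall g, `|f g| <= M.
Proof.
move=> cf; have cf' : continuous (fun g => (f g)%:C%C : C R).
  by move=> g; apply: cvgC_ReIm => /=; [exact: cf|exact: cvg_cst].
have [M _ hM] := continuous_bounded cT cf'; exists (complex.Re M) => g.
have := le_trans (normc_ge_Re _) (hM g).
by case: (M) => a b; rewrite lecE /= => /andP[].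
Qed.

Lemma haar_setT : mu [set: borel T] = 1%E.
Proof. exact: probability_setT. Qed.

Lemma continuous_integrable (f : T -> R) : continuous f ->
  mu.-integrable [set: borel T] (EFin \o f).
Proof.
move=> cf; apply: measurable_bounded_integrable => //.
- have h : (mu [set: borel T] < +oo)%E by rewrite haar_setT ltry.
  exact: h.
- exact: continuous_measurable_borel.
- have [M hM] := real_continuous_bounded cf.
  exists M; split; first exact: num_real.
  by move=> x Mx g _; apply: le_trans (hM g) _; exact: ltW.
Qed.

Lemma Rint_mulgl (f : T -> R) (t : T) : continuous f -> RI (fun g => f (t * g)%g) = RI f.
Proof.
move=> cf; rewrite /Rintegral; congr fine.
pose phi : borel T -> borel T := fun g => (t * g)%g.
have mphi : measurable_fun [set: borel T] phi.
  apply: (@measurability _ _ (borel T) (borel T) setT phi (@open T)) => //.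
  move=> _ [A oA <-]; rewrite setTI; apply: sub_sigma_algebra.
  by move/continuousP: (@continuous_mulgl T t); exact.
have ci := continuous_integrable (continuous_comp_mulgl (t := t) cf).
have := @integral_pushforward _ _ (borel T) (borel T) R phi mphi mu setT (EFin \o f) _ _ _.
rewrite preimage_setT => <- //; last first.
  by apply/measurable_EFinP; exact: continuous_measurable_borel.
apply: eq_measure_integral => A mA _; rewrite /pushforward.
have [inv _] := hmu; have mA' : measurable (phi @^-1` A).
  by rewrite -[X in measurable X]setTI; exact: mphi.
(* Invariance is stated for image sets, so [A] is presented as the translate by [t] of its own
   preimage. *)
have := inv t _ mA'.
have -> : [set (t * x)%g | x in phi @^-1` A] = A.
  rewrite eqEsubset; split => [x [y Ay <-]|x Ax]; first exact: Ay.
  by exists (t^-1 * x)%g; rewrite /phi /= ?mulVKg.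
by move=> h; exact: (esym h).
Qed.

Lemma RintD (f g : T -> R) : continuous f -> continuous g ->
  RI (fun x => f x + g x) = RI f + RI g.
Proof. by move=> cf cg; apply: RintegralD => //; exact: continuous_integrable. Qed.

Lemma RintZ (a : R) (f : T -> R) : continuous f -> RI (fun x => a * f x) = a * RI f.
Proof. by move=> cf; apply: RintegralZl => //; exact: continuous_integrable. Qed.

Lemma Rint_cst (a : R) : RI (fun=> a) = a.
Proof.
rewrite Rintegral_cst //; have h := congr1 fine haar_setT.
by rewrite (_ : fine _ = 1) ?mulr1.
Qed.

Lemma Rint_le (f g : T -> R) : continuous f -> continuous g -> (forall x, f x <= g x) ->
  RI f <= RI g.
Proof.
by move=> cf cg fg; apply: le_Rintegral => //; exact: continuous_integrable.
Qed.

Lemma Rint_sum (J : Type) (s : seq J) (f : J -> T -> R) : (forall j, continuous (f j)) ->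
  RI (fun x => \sum_(j <- s) f j x) = \sum_(j <- s) RI (f j).
Proof.
move=> cf; elim: s => [|j s IH].
  by under eq_Rintegral do rewrite big_nil; rewrite Rint_cst big_nil.
under eq_Rintegral do rewrite big_cons.
rewrite RintD // ?IH ?big_cons // => x.
by apply: cvg_sum_seq => i _; exact: cf.
Qed.

(* Finitely many translates of [f] add up to a function bounded below by a
   positive constant. *)
Lemma Rint_gt0 (f : T -> R) (g0 : T) : continuous f -> (forall x, 0 <= f x) -> 0 < f g0 ->
  0 < RI f.
Proof.
move=> cf f0 fg0; pose V s := [set g | f g0 / 2 < f (s * g)%g].
have := cT; rewrite compact_cover => /(_ T setT V) [].
- move=> s _; have /continuousP := continuous_comp_mulgl (t := s) cf.
  by move=> /(_ _ (@open_gt _ (f g0 / 2))).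
- move=> g _; exists (g0 * g^-1)%g => //; rewrite /V /= mulgVK.
  by rewrite gtr_pMr // invf_lt1 ?ltr1n.
move=> D _ cov.
have [IF0|//] : RI f = 0 \/ 0 < RI f.
  have := Rintegral_ge0 mu (D := setT) (f := f) (fun x _ => f0 x).
  by rewrite le_eqVlt => /orP[/eqP <-|]; [left|right].
have h : 0 < f g0 / 2 by rewrite divr_gt0.
have : RI (fun=> f g0 / 2) <= RI (fun g => \sum_(s <- enum_fset D) f (s * g)%g).
  apply: Rint_le => [||g]; first by move=> x; exact: cvg_cst.
    by move=> x; apply: cvg_sum_seq => s _; exact: (continuous_comp_mulgl (t := s) cf).
  have [s Ds /ltW Vs] := cov g Logic.I; apply: le_trans Vs _.
  by rewrite (big_rem s) //= lerDl sumr_ge0.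
rewrite Rint_cst Rint_sum; last by move=> s; exact: (continuous_comp_mulgl (t := s) cf).
by rewrite big1_seq => [|s _]; [rewrite leNgt h|rewrite Rint_mulgl].
Qed.

End HaarIntegral.

(** * Integrals of complex-valued continuous functions *)

Section ComplexIntegral.
Variables (R : realType) (T : topologicalGroupType) (mu : probability (borel T) R).
Hypothesis cT : compact [set: T].
Hypothesis hmu : haar mu.
Implicit Types f g : T -> C R.

Local Notation CI := (integral_complex mu).
Local Notation RI f := (\int[mu]_x f x)%R.

Lemma continuous_Re f : continuous f -> continuous (fun x => complex.Re (f x)).
Proof. by move=> cf x; apply: cvgC_Re; exact: cf. Qed.

Lemma continuous_Im f : continuous f -> continuous (fun x => complex.Im (f x)).
Proof. by move=> cf x; apply: cvgC_Im; exact: cf. Qed.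

Lemma ReD (x y : C R) : complex.Re (x + y) = complex.Re x + complex.Re y.
Proof. by case: x y => a b [c d]. Qed.

Lemma ImD (x y : C R) : complex.Im (x + y) = complex.Im x + complex.Im y.
Proof. by case: x y => a b [c d]. Qed.

Lemma ReM (x y : C R) :
  complex.Re (x * y) = complex.Re x * complex.Re y + (- complex.Im x) * complex.Im y.
Proof. by case: x y => a b [c d] /=; rewrite mulNr. Qed.

Lemma ImM (x y : C R) :
  complex.Im (x * y) = complex.Re x * complex.Im y + complex.Im x * complex.Re y.
Proof. by case: x y => a b [c d]. Qed.

Lemma cintD f g : continuous f -> continuous g ->
  CI (fun x => f x + g x) = CI f + CI g.
Proof.
move=> cf cg; rewrite /integral_complex.
under eq_Rintegral do rewrite ReD.
rewrite RintD //; [|exact: continuous_Re|exact: continuous_Re].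
under [X in Complex _ X]eq_Rintegral do rewrite ImD.
by rewrite RintD //; exact: continuous_Im.
Qed.

Lemma cintZ (a : C R) f : continuous f -> CI (fun x => a * f x) = a * CI f.
Proof.
move=> cf; have [cr ci] := (continuous_Re cf, continuous_Im cf).
have cZ (b : R) (h : T -> R) : continuous h -> continuous (fun x => b * h x).
  by move=> ch x; apply: cvgMr; exact: ch.
rewrite /integral_complex.
under eq_Rintegral do rewrite ReM.
rewrite RintD ?RintZ //; [|exact: cZ|exact: cZ].
under [X in Complex _ X]eq_Rintegral do rewrite ImM.
rewrite RintD ?RintZ //; [|exact: cZ|exact: cZ].
by case: (a) => u v /=; rewrite mulNr.
Qed.

Lemma cint_cst (a : C R) : CI (fun=> a) = a.
Proof. by rewrite /integral_complex !Rint_cst; case: a. Qed.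

Lemma cint_sum (J : Type) (s : seq J) (P : pred J) (f : J -> T -> C R) :
  (forall j, continuous (f j)) ->
  CI (fun x => \sum_(j <- s | P j) f j x) = \sum_(j <- s | P j) CI (f j).
Proof.
move=> cf; elim: s => [|j s IH].
  by rewrite big_nil -[RHS](cint_cst 0); congr (CI _); apply/funext => x; rewrite big_nil.
under eq_fun do rewrite big_cons; rewrite big_cons; case: ifP => // Pj.
rewrite cintD ?IH // => x.
by apply: cvg_sum_seq => i _; exact: cf.
Qed.

Lemma cint_mulgl f (t : T) : continuous f -> CI (fun x => f (t * x)%g) = CI f.
Proof.
move=> cf; rewrite /integral_complex; congr Complex.
  by rewrite (Rint_mulgl cT hmu t (continuous_Re cf)).
by rewrite (Rint_mulgl cT hmu t (continuous_Im cf)).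
Qed.

Lemma cint_gt0 f (g0 : T) : continuous f -> (forall x, 0 <= f x) -> 0 < f g0 -> 0 < CI f.
Proof.
move=> cf f0 fg0.
have Im0 x : complex.Im (f x) = 0 by have := f0 x; rewrite lecE => /andP[/eqP].
have Re0 x : 0 <= complex.Re (f x) by have := f0 x; rewrite lecE => /andP[].
rewrite /integral_complex ltcE /=; apply/andP; split.
  by under eq_Rintegral do rewrite Im0; rewrite Rint_cst.
apply: (Rint_gt0 cT hmu (g0 := g0) (continuous_Re cf)) => //.
by move: fg0; rewrite ltcE => /andP[].
Qed.

Lemma cint_ge0 f : continuous f -> (forall x, 0 <= f x) -> 0 <= CI f.
Proof.
move=> cf f0; have [[g0 fg0]|H] := pselect (exists x0 : T, 0 < f x0).
  exact/ltW/(cint_gt0 cf f0 fg0).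
rewrite (_ : f = fun=> 0) ?cint_cst //; apply/funext => x.
apply/eqP; rewrite eq_le f0 andbT; apply/negP => /negP; apply: contra_notP H => h.
exists x; rewrite lt_neqAle f0 andbT; apply/eqP => e; apply: h; rewrite -e lexx.
by [].
Qed.

(** Real and imaginary parts are bounded separately, which is the source of the factor 2. *)
Lemma norm_cint_le f (M : C R) : continuous f -> (forall x, `|f x| <= M) ->
  `|CI f| <= M *+ 2.
Proof.
move=> cf fM; have M0 : 0 <= M := le_trans (normr_ge0 _) (fM 1%g).
have [m m0 eM] : exists2 m : R, 0 <= m & M = m%:C%C.
  by case: (M) M0 => a b; rewrite lecE /= => /andP[/eqP -> a0]; exists a.
have bnd (h : T -> R) : continuous h -> (forall x, `|h x| <= m) -> `|RI h| <= m.
  move=> ch hM; have cc (a : R) : continuous (fun _ : T => a) by move=> x; exact: cvg_cst.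
  have hM' x : - m <= h x <= m by rewrite -ler_norml.
  rewrite ler_norml -{1}(Rint_cst mu (- m)) -{2}(Rint_cst mu m).
  by apply/andP; split; apply: Rint_le => // x; have /andP[] := hM' x.
have fm x : `|f x| <= m%:C%C by rewrite -eM.
rewrite eM.
apply: le_trans (normC_le_ReIm _) _; rewrite mulr2n -rmorphD lecR /= lerD //; apply: bnd.
- exact: continuous_Re.
- by move=> x; rewrite -lecR; apply: le_trans (normc_ge_Re _) (fm x).
- exact: continuous_Im.
- by move=> x; rewrite -lecR; apply: le_trans (normC_ge_Im _) (fm x).
Qed.

End ComplexIntegral.

(* Otherwise [//] unfolds Lebesgue integrals when it compares two integrals. *)
#[local] Opaque integral_complex.

(** * Toeplitz forms and roots of unity *)

(** For [n] nonzero in [K] the polynomial [X^n - 1] is separable, so it has [n] distinct roots, and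
    these must include a primitive one. *)
Lemma prim_root_closed_exists (K : closedFieldType) (n : nat) :
  n%:R != 0 :> K -> exists z : K, n.-primitive_root z.
Proof.
move=> nz; have n0 : (0 < n)%N by case: n nz; rewrite ?eqxx.
have [rs] := closed_field_poly_normal ('X^n - 1 : {poly K}).
rewrite (monicP (monicXnsubC 1 n0)) scale1r => rsE.
suff /hasP[z _ zP] : has n.-primitive_root rs by exists z.
apply: has_prim_root => //.
- by apply/allP => z; rewrite -root_prod_XsubC -rsE.
- by rewrite -separable_prod_XsubC -rsE separable_Xn_sub_1.
- by rewrite -ltnS -(size_prod_XsubC _ id) -rsE size_XnsubC.
Qed.

Section RootsOfUnity.
Variable K : numClosedFieldType.

Lemma norm_prim_root (L : nat) (z : K) : (0 < L)%N -> L.-primitive_root z -> `|z| = 1.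
Proof.
move=> L0 zL; have := congr1 Num.norm (prim_expr_order zL).
by rewrite normrX normr1 => /eqP; rewrite pexpr_eq1 // => /eqP.
Qed.

Lemma norm1_mulC (l : K) : `|l| = 1 -> l * l^* = 1.
Proof. by move=> l1; rewrite -normCK l1 expr1n. Qed.

(** Orthogonality of the characters of Z/L: the sum is geometric with ratio [w], the power of [z]
    with exponent m - n, which is 1 only for m = n since both exponents are below [L]. *)
Lemma sum_prim_root (L : nat) (z : K) (m n : nat) : L.-primitive_root z ->
  (m < L)%N -> (n < L)%N ->
  \sum_(l < L) (z ^+ l) ^+ m * ((z ^+ l)^*) ^+ n = (L * (m == n))%:R.
Proof.
move=> zL mL nL; have L0 : (0 < L)%N by apply: leq_ltn_trans mL.
have z1 := norm_prim_root L0 zL.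
pose w := z ^+ m * (z^*) ^+ n.
have -> : \sum_(l < L) (z ^+ l) ^+ m * ((z ^+ l)^*) ^+ n = \sum_(l < L) w ^+ l.
  by apply: eq_bigr => l _; rewrite rmorphXn /= exprMn -!exprM ![(l * _)%N]mulnC.
have wz : w * z ^+ n = z ^+ m.
  by rewrite /w -mulrA -exprMn mulrC [z^* * z]mulrC norm1_mulC // expr1n mul1r.
have [mn|mn] := eqVneq m n.
  have -> : w = 1 by rewrite /w mn -exprMn norm1_mulC // expr1n.
  by under eq_bigr do rewrite expr1n; rewrite muln1 sumr_const card_ord.
rewrite muln0; have wL : w ^+ L = 1.
  rewrite /w exprMn -!exprM ![(_ * L)%N]mulnC !exprM -rmorphXn /=.
  by rewrite (prim_expr_order zL) rmorph1 !expr1n mulr1.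
have w1 : w - 1 != 0.
  rewrite subr_eq0; apply: contra mn => /eqP w1; move: wz; rewrite w1 mul1r => /eqP.
  by rewrite eq_sym (eq_prim_root_expr zL) !modn_small.
by apply: (mulfI w1); rewrite -subrX1 wL subrr mulr0.
Qed.

End RootsOfUnity.

(** Exactly 2q - |a - b| pairs i, j below 2q satisfy i - j = a - b. This is the Fejer weight of
    order 2q, at least q on all differences of numbers below q. *)
Lemma count_shifts (q a b : nat) : (a < q)%N -> (b < q)%N ->
  (q <= \sum_(i < 2 * q) \sum_(j < 2 * q) (i + b == j + a))%N.
Proof.
move=> aq bq.
rewrite -(big_mkord xpredT (fun i => \sum_(j < 2 * q) (i + b == j + a : nat)))%N.
(* Only the q indices i from a to a + q - 1 are kept; i = s + a is matched by j = b + s. *)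
rewrite (big_cat_nat (n := a)) //=; last by lia.
apply: leq_trans (leq_addl _ _); rewrite (big_cat_nat (n := (a + q)%N)) //=; try lia.
apply: leq_trans (leq_addr _ _).
rewrite -{1}[q]card_ord -sum1_card -{1}[a]add0n big_addn addKn big_mkord.
apply: leq_sum => s _.
have lt : (b + s < 2 * q)%N by have := ltn_ord s; lia.
rewrite (bigD1 (Ordinal lt)) //=.
by rewrite (_ : (s + a + b == b + s + a)%N = true) ?leq_addr //; apply/eqP; lia.
Qed.

(** Cauchy-Schwarz for the sizes [n i] of the colour classes: they add up to q, and their squares
    add up to the number of monochromatic pairs. *)
Lemma count_same_color (d : nat) (col : nat -> 'I_d) (q : nat) :
  (q ^ 2 <= d * \sum_(a < q) \sum_(b < q) (col a == col b))%N.
Proof.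
pose n i := (\sum_(a < q) (col a == i))%N.
have sn : (\sum_i n i = q)%N.
  rewrite /n exchange_big /= -[RHS]card_ord -sum1_card; apply: eq_bigr => a _.
  by rewrite (bigD1 (col a)) //= eqxx big1 // => i; rewrite eq_sym => /negPf ->.
have -> : (\sum_(a < q) \sum_(b < q) (col a == col b) = \sum_i n i * n i)%N.
  under [RHS]eq_bigr do rewrite /n big_distrlr /=.
  rewrite [RHS]exchange_big /=; apply: eq_bigr => a _; rewrite [RHS]exchange_big /=.
  apply: eq_bigr => b _; rewrite (bigD1 (col a)) //= eqxx mul1n eq_sym.
  by rewrite big1 ?addn0 // => i; rewrite eq_sym => /negPf ->.
rewrite -(leq_pmul2l (isT : 0 < 2)%N).
have -> : (2 * q ^ 2 = \sum_i \sum_j 2 * (n i * n j))%N.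
  rewrite -{1}sn expnS expn1 big_distrlr /= big_distrr /=.
  by apply: eq_bigr => i _; rewrite big_distrr.
have -> : (2 * (d * \sum_i n i * n i) = \sum_(i < d) \sum_(j < d) (n i ^ 2 + n j ^ 2))%N.
  under [RHS]eq_bigr do rewrite big_split /= sum_nat_const card_ord.
  rewrite big_split /= sum_nat_const card_ord -big_distrr /= mul2n -addnn.
  by congr (_ * _ + _ * _)%N; apply: eq_bigr.
by apply: leq_sum => i _; apply: leq_sum => j _; exact: nat_Cauchy.
Qed.

(** * Fejer means of positive Toeplitz sequences *)

Section Fejer.
Variables (K : numClosedFieldType) (c : nat -> nat -> K).
Hypothesis cS : forall a b s, c (a + s)%N (b + s)%N = c a b.

(** For [l] on the unit circle this is [n] times the Fejer mean of order [n], at [l], of the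
    sequence whose value at a - b is [c a b]. *)
Definition toeplitz_form (n : nat) (l : K) : K :=
  \sum_(a < n) \sum_(b < n) l ^+ a * (l^*) ^+ b * c a b.

Hypothesis form_ge0 : forall n l, `|l| = 1 -> 0 <= toeplitz_form n l.

Lemma toeplitz_eq a b a' b' : (a + b' = b + a')%N -> c a b = c a' b'.
Proof.
move=> e; have [h|h] := leqP a a'.
  by rewrite -(subnKC h) (_ : b' = b + (a' - a))%N ?cS //; lia.
by rewrite -(subnKC (ltnW h)) (_ : b = b' + (a - a'))%N ?cS //; lia.
Qed.

(** By orthogonality only the diagonal a = b survives, and all diagonal entries equal [c 0 0]. *)
Lemma sum_toeplitz_form (q L : nat) (z : K) : (q <= L)%N -> L.-primitive_root z ->
  \sum_(l < L) toeplitz_form q (z ^+ l) = L%:R * q%:R * c 0 0.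
Proof.
move=> qL zL; rewrite /toeplitz_form exchange_big /=.
under eq_bigr do rewrite exchange_big /=.
have E (a b : 'I_q) : \sum_(l < L) (z ^+ l) ^+ a * ((z ^+ l)^*) ^+ b * c a b
    = (L * (a == b))%:R * c a b.
  by rewrite -mulr_suml sum_prim_root // (leq_trans (ltn_ord _) qL).
under eq_bigr do under eq_bigr do rewrite E.
have E2 (a : 'I_q) : \sum_(b < q) (L * (a == b))%:R * c a b = L%:R * c 0 0.
  rewrite (bigD1 a) //= eqxx muln1 big1 ?addr0 => [|b]; last first.
    by rewrite eq_sym => /negPf ->; rewrite muln0 mul0r.
  by congr (_ * _); apply: toeplitz_eq; rewrite addn0.
under eq_bigr do rewrite E2.
by rewrite sumr_const card_ord -[LHS]mulr_natl; ring.
Qed.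

(** Parseval: the terms with i + b = j + a survive, and as both sums are below 3q, no others are
    identified modulo [L]. Each squared norm then carries the weight bounded in [count_shifts]. *)
Lemma sum_toeplitz_form_mul (q L : nat) (z : K) : (0 < q)%N -> (3 * q <= L)%N ->
  L.-primitive_root z ->
  L%:R * q%:R * \sum_(a < q) \sum_(b < q) `|c a b| ^+ 2 <=
  \sum_(l < L) toeplitz_form (2 * q) (z ^+ l) * toeplitz_form q (z ^+ l).
Proof.
move=> q0 qL zL; have L0 : (0 < L)%N by lia.
have z1 := norm_prim_root L0 zL.
have zl1 (l : nat) : `|z ^+ l| = 1 by rewrite normrX z1 expr1n.
have -> : \sum_(l < L) toeplitz_form (2 * q) (z ^+ l) * toeplitz_form q (z ^+ l) =
    \sum_(a < q) \sum_(b < q) \sum_(i < 2 * q) \sum_(j < 2 * q)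
      (L * (i + b == j + a)%N)%:R * (c i j * (c a b)^*).
  have E l : toeplitz_form (2 * q) (z ^+ l) * toeplitz_form q (z ^+ l) =
     \sum_(a < q) \sum_(b < q) \sum_(i < 2 * q) \sum_(j < 2 * q)
       (z ^+ l) ^+ (i + b) * ((z ^+ l)^*) ^+ (j + a) * (c i j * (c a b)^*).
    (* The second factor is real, so its conjugate is expanded instead; the surviving products then
       become squared norms. *)
    rewrite -[toeplitz_form q _](CrealP (ger0_real (form_ge0 q (zl1 l)))).
    rewrite {2}/toeplitz_form rmorph_sum mulr_sumr /=; apply: eq_bigr => a _.
    rewrite rmorph_sum mulr_sumr /=; apply: eq_bigr => b _.
    rewrite /toeplitz_form mulr_suml; apply: eq_bigr => i _.
    rewrite mulr_suml; apply: eq_bigr => j _.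
    by rewrite !rmorphM /= !rmorphXn /= conjCK !exprD; ring.
  under eq_bigr do rewrite E.
  rewrite exchange_big /=; apply: eq_bigr => a _; rewrite exchange_big /=.
  apply: eq_bigr => b _; rewrite exchange_big /=; apply: eq_bigr => i _.
  rewrite exchange_big /=; apply: eq_bigr => j _.
  rewrite -mulr_suml sum_prim_root //.
    by have := (ltn_ord i, ltn_ord b); case; lia.
  by have := (ltn_ord j, ltn_ord a); case; lia.
rewrite mulr_sumr; apply: ler_sum => a _; rewrite mulr_sumr; apply: ler_sum => b _.
have E : \sum_(i < 2 * q) \sum_(j < 2 * q) (L * (i + b == j + a)%N)%:R * (c i j * (c a b)^*) =
    L%:R * (\sum_(i < 2 * q) \sum_(j < 2 * q) (i + b == j + a)%N)%:R * `|c a b| ^+ 2.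
  rewrite !natr_sum mulr_sumr mulr_suml; apply: eq_bigr => i _.
  rewrite natr_sum mulr_sumr mulr_suml; apply: eq_bigr => j _.
  have [e|_] := eqVneq (i + b)%N (j + a)%N; last by rewrite muln0 mulr0 !mul0r.
  by rewrite muln1 mulr1 (toeplitz_eq e) normCK.
rewrite E ler_wpM2r ?exprn_ge0 // ler_wpM2l // ler_nat.
exact: count_shifts.
Qed.

(* The values of [toeplitz_form q] serve as nonnegative weights: some value of
   [toeplitz_form (2 * q)] is at least the weighted mean. *)
Lemma toeplitz_form_large (q : nat) (eta : K) : (0 < q)%N -> 0 < eta -> 0 < c 0 0 ->
  eta * q%:R ^+ 2 <= \sum_(a < q) \sum_(b < q) `|c a b| ^+ 2 ->
  exists2 l, `|l| = 1 & eta * q%:R ^+ 2 <= 2 * (toeplitz_form (2 * q) l * c 0 0).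
Proof.
move=> q0 eta0 c0 etaP; pose L := (3 * q)%N.
have L0 : 0 < L%:R :> K by rewrite ltr0n; lia.
have q0' : 0 < q%:R :> K by rewrite ltr0n.
have [z zL] : exists z : K, L.-primitive_root z.
  by apply: prim_root_closed_exists; rewrite lt0r_neq0.
have z1 : `|z| = 1 by apply: (norm_prim_root _ zL); lia.
have zl1 (l : nat) : `|z ^+ l| = 1 by rewrite normrX z1 expr1n.
apply: contrapT => H.
(* Both sides are real, hence comparable, so the negated conclusion bounds the values at all roots
   of unity from above. *)
have lt (l : nat) : 2 * (toeplitz_form (2 * q) (z ^+ l) * c 0 0) <= eta * q%:R ^+ 2.
  have [//|le] : 2 * (toeplitz_form (2 * q) (z ^+ l) * c 0 0) <= eta * q%:R ^+ 2 \/
      eta * q%:R ^+ 2 <= 2 * (toeplitz_form (2 * q) (z ^+ l) * c 0 0).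
    by apply/orP; apply: real_leVge; rewrite ger0_real ?mulr_ge0 ?exprn_ge0 ?form_ge0 ?ltW.
  by exfalso; apply: H; exists (z ^+ l).
have qL : (q <= L)%N by rewrite /L; lia.
have S1 := sum_toeplitz_form qL zL.
have S2 := sum_toeplitz_form_mul q0 (leqnn _) zL.
have S3 : 2 * c 0 0 * \sum_(l < L) toeplitz_form (2 * q) (z ^+ l) * toeplitz_form q (z ^+ l)
    <= eta * q%:R ^+ 2 * (L%:R * q%:R * c 0 0).
  rewrite -S1 !mulr_sumr; apply: ler_sum => l _.
  by rewrite mulrA ler_wpM2r ?form_ge0 // -mulrA [c 0 0 * _]mulrC.
have : 2 * c 0 0 * (L%:R * q%:R * (eta * q%:R ^+ 2)) <= eta * q%:R ^+ 2 * (L%:R * q%:R * c 0 0).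
  apply: le_trans S3; apply: ler_wpM2l; first by rewrite mulr_ge0 // ltW.
  by apply: le_trans S2; apply: ler_wpM2l etaP; rewrite mulr_ge0 // ltW.
(* The upper and lower bounds combine to [2 * y <= y] with [y] positive. *)
have -> : 2 * c 0 0 * (L%:R * q%:R * (eta * q%:R ^+ 2)) =
   2 * (eta * q%:R ^+ 2 * (L%:R * q%:R * c 0 0)) by ring.
set y := eta * _ * _; have y0 : 0 < y by rewrite !mulr_gt0 ?exprn_gt0.
have : y < 2 * y by rewrite ltr_pMl ?ltr1n.
by move=> /lt_le_trans /[apply]; rewrite ltxx.
Qed.

End Fejer.

(** * Eigenfunctions of translations *)

Lemma near_divn_le (R : realType) (M e : C R) : 0 <= M -> 0 < e ->
  \forall n \near \oo, M / n%:R <= e.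
Proof.
move=> M0 e0; have [n hn] := archiC (M / e).
exists n.+1 => // m /= nm; have m0 : 0 < m%:R :> C R by rewrite ltr0n (leq_trans _ nm).
rewrite ler_pdivrMr // mulrC -ler_pdivrMr //.
have Me : 0 <= M / e by rewrite divr_ge0 // ltW.
rewrite (ger0_norm Me) in hn.
by apply: le_trans hn _; rewrite ler_nat ltnW.
Qed.

Lemma norm1_cvg (R : realType) (I : Type) (U : set_system I) (u : I -> C R) (l : C R) :
  ProperFilter U -> u @ U --> l -> (forall i, `|u i| = 1) -> `|l| = 1.
Proof.
move=> UU ul u1.
have h : (fun i => `|u i|) @ U --> `|l| by apply: cvg_norm.
have h1 : (fun i => `|u i|) @ U --> (1 : C R).
  by under eq_fun do rewrite u1; exact: cvg_cst.
exact: cvg_unique h h1.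
Qed.

Section Eigenfunction.
Variables (R : realType) (T : topologicalGroupType) (mu : probability (borel T) R).
Hypothesis cT : compact [set: T].
Hypothesis hmu : haar mu.
Implicit Types f g : T -> C R.

Local Notation CI := (integral_complex mu).

Lemma continuous_normsq f : continuous f -> continuous (fun x => `|f x| ^+ 2).
Proof.
by move=> cf x; rewrite /continuous_at; under eq_fun do rewrite expr2; rewrite expr2;
  apply: cvgM; apply: cvg_norm; exact: cf.
Qed.

Lemma continuous_conj f : continuous f -> continuous (fun x => (f x)^*).
Proof.
move=> cf x; apply/cvgrPdist_lt => e e0.
have /cvgrPdist_lt /(_ e e0) := cf x; apply: filterS => y.
by rewrite -rmorphB /= norm_conjC.
Qed.

Lemma cint_uniform_cvg (I : Type) (U : set_system I) (f : I -> T -> C R) (h : T -> C R) :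
  Filter U -> (forall i, continuous (f i)) -> continuous h ->
  (forall e : C R, 0 < e -> \forall i \near U, forall x, `|h x - f i x| <= e) ->
  (fun i => CI (f i)) @ U --> CI h.
Proof.
move=> FU cf ch fh; apply/cvgrPdist_lt => e e0.
(* The bound [norm_cint_le] loses a factor 2, so [e / 4] leaves [e / 2], which is below [e]. *)
have e4 : 0 < e / 4 by rewrite divr_gt0.
apply: filterS (fh _ e4) => i hi.
have cB : continuous (fun x => h x + (-1) * f i x).
  by move=> x; apply: cvgD; [exact: ch|apply: cvgMr; exact: cf].
have cN : continuous (fun x => (-1) * f i x) by move=> x; apply: cvgMr; exact: cf.
have -> : CI h - CI (f i) = CI (fun x => h x + (-1) * f i x).
  by rewrite (cintD mu cT ch cN) (cintZ mu cT _ (cf i)) mulN1r.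
apply: le_lt_trans (norm_cint_le mu cT (M := e / 4) cB _) _.
  by move=> x; rewrite mulN1r.
by rewrite -[ltLHS]mulr_natl (_ : 2 * (e / 4) = e / 2) ?gtr_pMr ?invf_lt1 ?ltr1n //; field.
Qed.

Variables (phi : T -> C R) (t : T).
Hypothesis cphi : continuous phi.

Let phi_ (a : nat) (x : T) := phi (t ^+ a * x)%g.
(** The Gram matrix of the translates for the L2 inner product; invariance of [mu] makes it a
    Toeplitz matrix. *)
Let c (a b : nat) := CI (fun x => phi_ a x * (phi_ b x)^*).

Lemma translate_continuous a : continuous (phi_ a).
Proof. exact: continuous_comp_mulgl. Qed.

Lemma translate_mul_continuous a b : continuous (fun x => phi_ a x * (phi_ b x)^*).
Proof.
by move=> x; apply: cvgM; [|apply: continuous_conj]; exact: translate_continuous.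
Qed.

Lemma translateS a x : phi_ a (t * x)%g = phi_ a.+1 x.
Proof. by rewrite /phi_ expgSr mulgA. Qed.

Lemma gram_toeplitz a b s : c (a + s)%N (b + s)%N = c a b.
Proof.
rewrite /c -(cint_mulgl cT hmu (t ^+ s)%g (translate_mul_continuous (a := a) (b := b))).
by congr (CI _); apply/funext => x; rewrite /phi_ !mulgA -!expgnDr.
Qed.

Lemma gram_form n l : toeplitz_form c n l =
  CI (fun x => `|\sum_(a < n) l ^+ a * phi_ a x| ^+ 2).
Proof.
have -> : (fun x => `|\sum_(a < n) l ^+ a * phi_ a x| ^+ 2) =
   fun x => \sum_(a < n) \sum_(b < n) (l ^+ a * (l^*) ^+ b) * (phi_ a x * (phi_ b x)^*).
  apply/funext => x; rewrite normCK rmorph_sum big_distrlr /=.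
  apply: eq_bigr => a _; apply: eq_bigr => b _.
  by rewrite rmorphM rmorphXn /=; ring.
have cc (a b : nat) : continuous (fun x => (l ^+ a * (l^*) ^+ b) * (phi_ a x * (phi_ b x)^*)).
  by move=> x; apply: cvgMr; exact: translate_mul_continuous.
rewrite (cint_sum mu cT); last first.
  by move=> a x; apply: cvg_sum_seq => b _; exact: cc.
apply: eq_bigr => a _; rewrite (cint_sum mu cT); last by move=> b; exact: cc.
apply: eq_bigr => b _.
by rewrite (cintZ mu cT _ (translate_mul_continuous (a := a) (b := b))).
Qed.

Lemma gram_form_ge0 n l : 0 <= toeplitz_form c n l.
Proof.
rewrite gram_form; apply: (cint_ge0 cT hmu); last by move=> x; rewrite exprn_ge0.
apply: continuous_normsq => x; apply: cvg_sum_seq => a _.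
by apply: cvgMr; exact: translate_continuous.
Qed.

Lemma gram00 : c 0 0 = CI (fun x => `|phi x| ^+ 2).
Proof. by rewrite /c; congr (CI _); apply/funext => x; rewrite /phi_ expg0 mul1g normCK. Qed.

Hypothesis phi0 : exists x, phi x != 0.

Lemma gram00_gt0 : 0 < c 0 0.
Proof.
have [x0 px] := phi0; rewrite gram00; apply: (cint_gt0 cT hmu (g0 := x0)).
- exact: continuous_normsq.
- by move=> x; rewrite exprn_ge0.
- by rewrite exprn_gt0 // normr_gt0.
Qed.

(** Almost periodicity: if two powers of [t] have the same colour, the translates are uniformly
    close and their inner product has norm at least [c 0 0 / 2]. At least a share 1/d of all pairs
    is of this kind. *)
Lemma gram_sum_ge : exists2 eta : C R, 0 < eta & forall q,
  eta * q%:R ^+ 2 <= \sum_(a < q) \sum_(b < q) `|c a b| ^+ 2.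
Proof.
have c0 := gram00_gt0.
have [M M0 phiM] := continuous_bounded cT cphi.
(* Chosen so that the error [2 * (e * M)] is at most [c 0 0 / 2]; the summand 1 keeps the
   denominator nonzero. *)
pose e := c 0 0 / (4 * (M + 1)).
have M1 : 0 < M + 1 by rewrite ltr_wpDl.
have e0 : 0 < e by rewrite divr_gt0 // mulr_gt0.
have [d [col colP]] := finite_coloring cT cphi e0.
have d0 : 0 < d%:R :> C R by rewrite ltr0n (leq_ltn_trans _ (ltn_ord (col 1%g))).
have big a b : col (t ^+ a)%g = col (t ^+ b)%g -> c 0 0 / 2 <= `|c a b|.
  move=> ab; have cbb : c b b = c 0 0 by rewrite -(gram_toeplitz 0 0 b).
  have : `|c b b - c a b| <= (e * M) *+ 2.
    have -> : c b b - c a b = CI (fun x => (phi_ b x - phi_ a x) * (phi_ b x)^*).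
      have -> : (fun x => (phi_ b x - phi_ a x) * (phi_ b x)^*) =
         fun x => phi_ b x * (phi_ b x)^* + (-1) * (phi_ a x * (phi_ b x)^*).
        by apply/funext => x; ring.
      have cN : continuous (fun x => (-1) * (phi_ a x * (phi_ b x)^*)).
        by move=> x; apply: cvgMr; exact: translate_mul_continuous.
      rewrite (cintD mu cT (translate_mul_continuous (a := b) (b := b)) cN).
      by rewrite (cintZ mu cT _ (translate_mul_continuous (a := a) (b := b))) mulN1r.
    apply: (norm_cint_le mu cT) => [x|x].
      by apply: cvgM; [apply: cvgB|apply: continuous_conj]; exact: translate_continuous.
    rewrite normrM norm_conjC ler_pM // /phi_; first by apply: colP.
    exact: phiM.
  rewrite cbb => h.
  have eM : (e * M) *+ 2 <= c 0 0 / 2.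
    rewrite -[leLHS]mulr_natl (_ : 2 * (e * M) = c 0 0 / 2 * (M / (M + 1))).
      apply: ler_piMr; first by rewrite divr_ge0 // ltW.
      by rewrite ler_pdivrMr // mul1r lerDl.
    by rewrite /e; field; rewrite lt0r_neq0.
  have := lerB_dist (c 0 0) (c a b); rewrite (ger0_norm (ltW c0)) => h2.
  have : c 0 0 - `|c a b| <= c 0 0 / 2 by apply: le_trans h2 (le_trans h eM).
  by rewrite lerBlDr addrC -lerBlDr {1}[c 0 0]splitr addrK.
exists ((c 0 0 / 2) ^+ 2 / d%:R) => [|q]; first by rewrite divr_gt0 // exprn_gt0 // divr_gt0.
apply: (@le_trans _ _ ((c 0 0 / 2) ^+ 2 *
    (\sum_(a < q) \sum_(b < q) (col (t ^+ a)%g == col (t ^+ b)%g))%N%:R)).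
  rewrite -mulrA; apply: ler_wpM2l; first by rewrite exprn_ge0 // divr_ge0 // ltW.
  rewrite mulrC ler_pdivrMr // mulrC -natrX -natrM ler_nat.
  exact: (count_same_color (fun a => col (t ^+ a)%g)).
rewrite natr_sum mulr_sumr; apply: ler_sum => a _.
rewrite natr_sum mulr_sumr; apply: ler_sum => b _.
have [ab|_] := eqVneq; last by rewrite mulr0 exprn_ge0.
by rewrite mulr1 lerXn2r // ?big // nnegrE ?divr_ge0 // ltW.
Qed.


Let psi_ (n : nat) (l : C R) (x : T) := \sum_(a < n) (n%:R^-1 * l ^+ a) * phi_ a x.

Lemma mean_kfam M W n l : (0 < n)%N -> `|l| = 1 -> 0 <= M -> kfam M W phi -> kfam M W (psi_ n l).
Proof.
move=> n0 l1 M0 kphi; apply: kfam_sum => // [a _|]; first exact: kfam_translate.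
have n0' : n%:R != 0 :> C R by rewrite pnatr_eq0 -lt0n.
under eq_bigr do rewrite normrM normrX l1 expr1n mulr1 ger0_norm ?invr_ge0 //.
by rewrite sumr_const card_ord -[leLHS]mulr_natl divff.
Qed.

(** Translation by [t] and multiplication by [l] move the summation index by one, so only two
    boundary terms remain, and the factor 1/n makes them negligible. *)
Lemma mean_shift n l x : l * psi_ n l (t * x)%g - psi_ n l x =
  n%:R^-1 * (l ^+ n * phi_ n x - phi_ 0 x).
Proof.
rewrite /psi_ mulr_sumr -sumrB.
rewrite -[phi_ 0 x]mul1r -[1 in RHS](expr0 l).
rewrite -(telescope_sumr (fun a => l ^+ a * phi_ a x) (leq0n n)) mulr_sumr big_mkord.
by apply: eq_bigr => a _; rewrite translateS exprS; ring.
Qed.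

Lemma cint_mean_normsq n l : `|l| = 1 ->
  CI (fun x => `|psi_ n l x| ^+ 2) = n%:R^-1 ^+ 2 * toeplitz_form c n l.
Proof.
move=> l1; rewrite gram_form -(cintZ mu cT); last first.
  apply: continuous_normsq => x; apply: cvg_sum_seq => a _.
  by apply: cvgMr; exact: translate_continuous.
congr (CI _); apply/funext => x; rewrite /psi_.
under eq_bigr do rewrite -mulrA.
by rewrite -mulr_sumr normrM exprMn ger0_norm ?invr_ge0.
Qed.

Lemma mean_normsq_large : exists2 delta : C R, 0 < delta & forall q,
  exists2 l, `|l| = 1 & delta <= CI (fun x => `|psi_ (2 * q.+1) l x| ^+ 2).
Proof.
have [eta eta0 etaP] := gram_sum_ge; have c0 := gram00_gt0.
(* The 8 is the factor 2 of [toeplitz_form_large] times the 4 from squaring the number [2 * q.+1] of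
   terms. *)
exists (eta / (8 * c 0 0)) => [|q]; first by rewrite divr_gt0 // mulr_gt0.
have [l l1 lP] := toeplitz_form_large gram_toeplitz (fun n l _ => gram_form_ge0 n l)
  (ltn0Sn q) eta0 c0 (etaP q.+1).
exists l => //; rewrite cint_mean_normsq // ler_pdivrMr ?mulr_gt0 //.
have q0 : 0 < q.+1%:R :> C R by rewrite ltr0n.
rewrite -(ler_pM2r (exprn_gt0 2 q0)); apply: le_trans lP _.
rewrite natrM le_eqVlt; apply/orP; left; apply/eqP; field.
by rewrite addrC natr1 pnatr_eq0.
Qed.

(** An ultrafilter limit of the means with large L2 norm. Equicontinuity makes it uniform, so the
    lower bound on the norm and a vanishing integral survive. The last clause passes to [psi] any
    coincidence of two group elements on all translates of [phi]. *)
Lemma translation_eigenfunction : exists (psi : T -> C R) (l : C R),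
  [/\ continuous psi, exists x, psi x != 0, `|l| = 1 & forall x, psi (t * x)%g = l * psi x] /\
  [/\ CI phi = 0 -> CI psi = 0 &
      forall s s', (forall a x, phi (t ^+ a * (s * x))%g = phi (t ^+ a * (s' * x))%g) ->
        forall x, psi (s * x)%g = psi (s' * x)%g].
Proof.
have [delta d0 /boolp.choice[l lP]] : exists2 delta : C R, 0 < delta & forall q, exists l,
    `|l| = 1 /\ delta <= CI (fun x => `|psi_ (2 * q.+1) l x| ^+ 2).
  have [delta d0 H] := mean_normsq_large; exists delta => // q.
  by have [l l1 lP] := H q; exists l.
have l1 q : `|l q| = 1 by have [] := lP q.
have [M [W [M0 mW kphi']]] := kfam_finite cT (f := fun _ : unit => phi) (fun _ => cphi).
have kphi := kphi' tt.
pose psi q := psi_ (2 * q.+1) (l q).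
have kpsi q : kfam M W (psi q) by apply: mean_kfam => //.
have [U [UU oU]] := @ultraFilterLemma nat \oo _.
have [h [kh hU]] := kfam_ultralimit cT UU mW kpsi.
have ch := kfam_continuous mW kh.
have cpsi q := kfam_continuous mW (kpsi q).
have [lam hlam] : exists lam : C R, l @ U --> lam.
  by apply: (ultra_cvgC (M := 1)) => q; rewrite l1.
have lam1 : `|lam| = 1 by apply: norm1_cvg hlam _.
have hcvg x : (fun q => psi q x) @ U --> h x.
  by apply/cvgrPdist_lt => e e0; apply: filterS (hU e e0) => q; exact.
(* By [mean_shift] the defect of each mean is at most [2 * M] divided by its number of terms. *)
have eig x : lam * h (t * x)%g = h x.
  apply/eqP; rewrite -subr_eq0 -normr_le0; apply/ler_addgt0Pr => e e0; rewrite add0r.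
  apply: (@cvg_norm_le R nat U _ (fun q => l q * psi q (t * x)%g - psi q x)).
    apply: (@cvgB _ _ _ U _ (fun q => l q * psi q (t * x)%g) (fun q => psi q x)).
      exact: cvgM hlam (hcvg (t * x)%g).
    exact: hcvg x.
  have [m _ hm] := near_divn_le M0 e0.
  apply: oU; exists m => // q /= mq; rewrite /psi mean_shift normrM.
  have b (a : nat) : `|l q ^+ a * phi_ a x| <= M.
    by rewrite normrM normrX l1 expr1n mul1r; have [bM _] := kphi; exact: bM.
  apply: (@le_trans _ _ ((2 * q.+1)%:R^-1 * (2 * M))).
    rewrite ger0_norm ?invr_ge0 //; apply: ler_wpM2l; first by rewrite invr_ge0.
    have -> : 2 * M = M + M by ring.
    apply: le_trans (ler_normB _ _) _; apply: lerD; first exact: b.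
    by have := b 0%N; rewrite expr0 mul1r.
  have := hm q.+1 (leqW mq); apply: le_trans.
  rewrite le_eqVlt natrM; apply/orP; left; apply/eqP; field.
  by rewrite addrC natr1 pnatr_eq0.
(* As [lam] is unimodular, the eigenvalue, its inverse, is its conjugate. *)
exists h, (lam^*); split; split=> //.
- apply: contrapT => h0.
  have hz x : h x = 0 by apply/eqP/negPn/negP => hx; apply: h0; exists x.
  have d1 : 0 < delta + 1 by rewrite ltr_wpDl // ltW.
  (* With this [e <= 1], the upper bound 2 e^2 is at most 2 e = delta / (delta + 1), which is less
     than the lower bound [delta]. *)
  pose e := delta / (2 * (delta + 1)).
  have e0 : 0 < e by rewrite divr_gt0 // mulr_gt0.
  have [q hq] := filter_ex (hU e e0).
  have : `|CI (fun x => `|psi q x| ^+ 2)| <= (e ^+ 2) *+ 2.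
    apply: (norm_cint_le mu cT (continuous_normsq (cpsi q))) => x.
    rewrite normrX normr_id; apply: lerXn2r; rewrite ?nnegrE //; first exact: ltW.
    by have := ltW (hq x); rewrite hz sub0r normrN.
  have := proj2 (lP q); rewrite -/(psi q) => dl.
  rewrite ger0_norm; last exact: le_trans (ltW d0) dl.
  move=> /(le_trans dl); apply/negP; rewrite -real_ltNge ?ger0_real ?mulrn_wge0 ?exprn_ge0 //;
    try exact: ltW.
  have e1 : e <= 1.
    rewrite ler_pdivrMr ?mulr_gt0 // mul1r (_ : 2 * (delta + 1) = delta + (delta + 2));
      last by ring.
    by rewrite lerDl addr_ge0 // ltW.
  apply: (@le_lt_trans _ _ (2 * e)).
    by rewrite -[leLHS]mulr_natl ler_wpM2l // expr2 ler_piMr // ltW.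
  have -> : 2 * e = delta / (delta + 1) by rewrite /e; field; rewrite lt0r_neq0.
  by rewrite ltr_pdivrMr // mulrDr mulr1 ltrDr mulr_gt0.
- by rewrite norm_conjC.
- by move=> x; rewrite -[in RHS]eig mulrA [lam^* * _]mulrC norm1_mulC // mul1r.
- move=> phi00.
  have CIpsi q : CI (psi q) = 0.
    rewrite /psi /psi_ (cint_sum mu cT) => [|a]; last first.
      by move=> x; apply: cvgMr; exact: translate_continuous.
    apply: big1 => a _; rewrite (cintZ mu cT _ (translate_continuous (a := a))).
    by rewrite /phi_ (cint_mulgl cT hmu _ cphi) phi00 mulr0.
  have cI : (fun q => CI (psi q)) @ U --> CI h.
    apply: cint_uniform_cvg => // e e0.
    by apply: filterS (hU e e0) => q hq x; exact/ltW/hq.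
  have c0 : (fun q => CI (psi q)) @ U --> (0 : C R).
    by under eq_fun do rewrite CIpsi; exact: cvg_cst.
  exact: cvg_unique cI c0.
- move=> s s' ss' x; have := hcvg (s' * x)%g.
  have -> : (fun q => psi q (s' * x)%g) = (fun q => psi q (s * x)%g).
    by apply/funext => q; apply: eq_bigr => a _; rewrite /phi_ ss'.
  by move=> h'; exact: cvg_unique (hcvg (s * x)%g) h'.
Qed.

End Eigenfunction.

Lemma closed_level_set (R : realType) (S : topologicalType) (f : S -> C R) (a : C R) :
  continuous f -> closed [set x | f x = a].
Proof.
move=> /continuous_closedP /(_ [set a]); apply.
exact: accessible_closed_set1 (hausdorff_accessible (@norm_hausdorff _ _)) a.
Qed.

(** * From common eigenfunctions to characters *)

Section Characters.
Variables (R : realType) (k : nat) (T : topologicalGroupType) (t : 'I_k -> T).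
Hypothesis genT : closed_subgroup_generated (range t) = [set: T].
Hypothesis noC : forall rho : T -> C R, unitary_character rho -> (exists x, rho x != 1) ->
     ~ in_one_coset (range t) (character_kernel rho).

Lemma eigenfunction_const (psi : T -> C R) (l : C R) (i0 : 'I_k) : continuous psi -> `|l| = 1 ->
  (forall i x, psi (t i * x)%g = l * psi x) -> forall x y, psi x = psi y.
Proof.
move=> cpsi l1 eig; have [[g0 pg0]|psi0] := pselect (exists x, psi x != 0); last first.
  have psiE x : psi x = 0 by apply/eqP/negPn/negP => px; apply: psi0; exists x.
  by move=> x y; rewrite !psiE.
have cr (g : T) : continuous (fun h => psi (h * g)%g).
  move=> h; apply: (@cvg_comp _ _ _ (fun h => (h * g)%g) psi); last exact: cpsi.
  by apply: cvg_mulg; [exact: cvg_id|exact: cvg_cst].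
pose rho h := psi (h * g0)%g / psi g0.
(* A scalar by which translation by [h] multiplies [psi] must be [rho h]. Hence [H] is cut out by
   equations between continuous functions and is closed; being a subgroup that contains the [t i],
   it is everything. *)
pose H := [set h | (forall x, psi (h * x)%g - rho h * psi x = 0) /\ `|rho h| = 1].
have crho : continuous rho by move=> h; apply: cvgMl; exact: cr.
have closedH : closed H.
  have -> : H = (\bigcap_x [set h | psi (h * x)%g - rho h * psi x = 0]) `&`
      [set h | `|rho h| = 1].
    by rewrite eqEsubset; split=> h [h1 h2]; split=> // x; [move=> _|]; exact: h1.
  apply: closedI; last by apply: closed_level_set => h; apply: cvg_norm; exact: crho.
  apply: closed_bigI => x _; apply: closed_level_set => h.
  by apply: cvgB; [exact: cr|apply: cvgMl; exact: crho].
have Hc h (c : C R) : `|c| = 1 -> (forall x, psi (h * x)%g = c * psi x) -> H h.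
  by move=> c1 hE; have E : rho h = c by [rewrite /rho hE mulfK];
    split=> [x|]; rewrite E ?hE ?subrr.
have HE h : H h -> forall x, psi (h * x)%g = rho h * psi x.
  by move=> [h1 _] x; apply/eqP; rewrite -subr_eq0 h1.
have subgroupH : subgroup H.
  split; first by apply: (Hc _ 1) => [|x]; rewrite ?normr1 ?mul1g ?mul1r.
    move=> x y Hx Hy; apply: (Hc _ (rho x * rho y)).
      by have [[_ hx] [_ hy]] := (Hx, Hy); rewrite normrM hx hy mulr1.
    by move=> z; rewrite -mulgA HE // HE // mulrA.
  move=> x Hx; have [_ rx] := Hx; apply: (Hc _ (rho x)^-1); first by rewrite normfV rx invr1.
  move=> z; have rx0 : rho x != 0 by rewrite -normr_eq0 rx oner_eq0.
  by apply: (mulfI rx0); rewrite mulrA divff // mul1r -HE // mulVKg.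
have allH h : H h.
  have : closed_subgroup_generated (range t) h by rewrite genT.
  by move=> /(_ H); apply; split=> // _ [i _ <-]; exact: (Hc _ l).
have rhoM x y : rho (x * y)%g = rho x * rho y.
  by rewrite {1}/rho -mulgA (HE _ (allH x)) (HE _ (allH y)) mulrA mulfK.
have rho_t i : rho (t i) = l by rewrite /rho eig mulfK.
have rho1 h : rho h = 1.
  apply: contrapT => rh; apply: (noC (rho := rho)).
  - by split=> // x; have [] := allH x.
  - by exists h; apply/eqP.
  - have l0 : l != 0 by rewrite -normr_eq0 l1 oner_eq0.
    exists (t i0) => _ [i _ <-]; exists ((t i0)^-1 * t i)%g; last by rewrite mulVKg.
    by apply: (mulfI l0); rewrite mulr1 -{1}(rho_t i0) -rhoM mulVKg rho_t.
move=> x y; rewrite -[x]mulg1 -[y]mulg1 (HE _ (allH x)) (HE _ (allH y)).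
by rewrite !rho1.
Qed.

End Characters.

(** * The double cover *)

Section Graph.
Variables (k : nat) (G : multigraph k).

Lemma adjacentP i j :
  reflect (exists e : edge G, source e = i /\ target e = j) (Defs.adjacent G i j).
Proof.
rewrite /Defs.adjacent /= mxE; apply: (iffP idP) => [/card_gt0P[e]|[e [<- <-]]].
  by rewrite inE => /andP[/eqP ? /eqP ?]; exists e.
by apply/card_gt0P; exists e; rewrite inE !eqxx.
Qed.

Lemma double_cover_sym : symmetric (double_cover G).
Proof. by case=> i [] j. Qed.

Let flip (x : 'I_k + 'I_k) : 'I_k + 'I_k :=
  match x with inl i => inr i | inr i => inl i end.

(** If the two lifts of [i0] were not joined, reachability of [inl j] from [inl i0] would be a
    proper 2-colouring. *)
Lemma undirected_nonbipartite_double_cover :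
  undirected G -> graph_connected G -> ~ bipartite G ->
  forall x y, connect (double_cover G) x y.
Proof.
move=> /eqP und [k0 conn] nbip; pose i0 : 'I_k := Ordinal k0.
have adjS i j : Defs.adjacent G i j = Defs.adjacent G j i by rewrite /Defs.adjacent /= -{1}und mxE.
have dcS := sym_connect_sym double_cover_sym.
(* Exchanging the two sheets is an automorphism because adjacency is symmetric. *)
have flipC x y : connect (double_cover G) x y -> connect (double_cover G) (flip x) (flip y).
  move=> /connectP[p pP ->] {y}; elim: p x pP => [|z p IH] x //= /andP[xz zp].
  apply: connect_trans (IH _ zp); apply: connect1.
  by case: x z xz {zp IH} => [i|i] [j|j] //=; rewrite adjS.
have reach j : connect (double_cover G) (inl i0) (inl j) \/
    connect (double_cover G) (inl i0) (inr j).
  have /connectP[p pP ->] := conn i0 j.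
  elim/last_ind: p pP => [_|p z IH]; first by left.
  rewrite rcons_path last_rcons => /andP[/IH H az].
  case: H => H; [right|left]; apply: connect_trans H _; apply: connect1 => //=.
  by rewrite adjS.
have sheets : connect (double_cover G) (inl i0) (inr i0).
  apply: contrapT => /negP nc; apply: nbip.
  exists (fun j => connect (double_cover G) (inl i0) (inl j)) => i j aij.
  (* Adjacent vertices of equal colour are reached on the same sheet, the left one or, by [reach],
     the right one. The edge between them changes sheets and so joins the two lifts of [i0]. *)
  apply/eqP => eij; move: nc; apply/negP; rewrite negbK.
  case ci : (connect (double_cover G) (inl i0) (inl i)) eij => /esym cj.
    apply: connect_trans ci (connect_trans (connect1 _) _).
      exact: (aij : double_cover G (inl i) (inr j)).
    by rewrite dcS; exact: flipC cj.
  have [|ci'] := reach i; first by rewrite ci.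
  have [|cj'] := reach j; first by rewrite cj.
  apply: connect_trans cj' _; rewrite dcS; apply: connect_trans (flipC _ _ ci') _.
  exact: connect1 (aij : double_cover G (inl i) (inr j)).
have base x : connect (double_cover G) (inl i0) x.
  case: x => j; case: (reach j) => // h.
    by apply: connect_trans sheets (flipC _ _ h).
  by apply: connect_trans sheets (flipC _ _ h).
by move=> x y; apply: connect_trans (base y); rewrite dcS.
Qed.

Lemma nonbipartite_double_cover : graph_connected G -> nonbipartite G ->
  forall x y, connect (double_cover G) x y.
Proof.
by rewrite /nonbipartite; case: ifP => // /undirected_nonbipartite_double_cover h /h.
Qed.

(** Moving between two out-neighbours of a vertex preserves [f]. In the double cover this is a move
    between right vertices through a left one, and connectedness links all right vertices. *)
Lemma nonbipartite_const (X : Type) (f : 'I_k -> X) :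
  graph_connected G -> nonbipartite G ->
  (forall e e' : edge G, source e = source e' -> f (target e) = f (target e')) ->
  forall i j, f i = f j.
Proof.
move=> conn nb fE i j.
(* A left vertex carries the claim for all its out-neighbours, so that [Q] propagates one step at a
   time. *)
pose Q (y : 'I_k + 'I_k) := match y with
  | inr j => f i = f j
  | inl l => forall e : edge G, source e = l -> f i = f (target e) end.
suff H y : Q y by exact: H (inr j).
have /connectP[p pP ->] := nonbipartite_double_cover conn nb (inr i) y.
elim/last_ind: p pP => [//|p z IH].
rewrite rcons_path last_rcons => /andP[/IH {IH}].
case: (last _ _) z => [l|l] [m|m] //=.
  by move=> H /adjacentP[e [se <-]]; exact: H.
by move=> -> /adjacentP[e [se <-]] e' se'; apply: fE; rewrite se se'.
Qed.

Lemma card_source r i : graph_regular G r -> #|[pred e : edge G | source e == i]| = r.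
Proof.
move=> [hr _]; rewrite -(hr i) -sum1_card (partition_big (@target k G) xpredT) //=.
by apply: eq_bigr => j _; rewrite mxE -sum1_card.
Qed.

Lemma card_target r j : graph_regular G r -> #|[pred e : edge G | target e == j]| = r.
Proof.
move=> [_ hr]; rewrite -(hr j) -sum1_card (partition_big (@source k G) xpredT) //=.
by apply: eq_bigr => i _; rewrite mxE -sum1_card; apply: eq_bigl => e; rewrite !inE andbC.
Qed.

(** The two lifts of a vertex are distinct, so a path joining them begins with an edge out of that
    vertex. *)
Lemma regular_degree_gt0 r :
  graph_connected G -> nonbipartite G -> graph_regular G r -> (0 < r)%N.
Proof.
move=> conn nb reg; have [k0 _] := conn; pose i0 : 'I_k := Ordinal k0.
have /connectP[[//|[j|j] p] //= /andP[/adjacentP[e [se _]] _] _] :=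
  nonbipartite_double_cover conn nb (inl i0) (inr i0).
by rewrite -(card_source i0 reg); apply/card_gt0P; exists e; rewrite inE se.
Qed.

End Graph.

(** * The walk operator *)

(** The gap in the Cauchy-Schwarz inequality written as a sum of squares, which turns its equality
    case into equality of all the values. *)
Lemma variance_identity (K : numClosedFieldType) (J : finType) (P : pred J) (x : J -> K) :
  \sum_(i | P i) \sum_(j | P j) `|x i - x j| ^+ 2 =
  2 * (#|P|%:R * \sum_(i | P i) `|x i| ^+ 2 - `|\sum_(i | P i) x i| ^+ 2).
Proof.
have E i j : `|x i - x j| ^+ 2 =
    `|x i| ^+ 2 + `|x j| ^+ 2 - (x i * (x j)^* + (x i)^* * x j).
  by rewrite !normCK rmorphB /=; ring.
under eq_bigr do under eq_bigr do rewrite E.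
under eq_bigr do rewrite big_split big_split /= sumrN big_split /=.
rewrite big_split big_split /= sumrN big_split /=.
have cst (a : K) : \sum_(i | P i) a = #|P|%:R * a by rewrite sumr_const mulr_natl.
have -> : \sum_(i | P i) \sum_(j | P j) `|x i| ^+ 2 = #|P|%:R * \sum_(i | P i) `|x i| ^+ 2.
  by rewrite mulr_sumr; apply: eq_bigr => i _; rewrite cst.
rewrite cst.
have -> : \sum_(i | P i) \sum_(j | P j) x i * (x j)^* = `|\sum_(i | P i) x i| ^+ 2.
  by rewrite normCK rmorph_sum big_distrlr.
have -> : \sum_(i | P i) \sum_(j | P j) (x i)^* * x j = `|\sum_(i | P i) x i| ^+ 2.
  by rewrite normCK rmorph_sum mulrC big_distrlr.
ring.
Qed.

Lemma nonincreasing_ge0_cvgC (R : realType) (s : nat -> C R) :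
  (forall n, 0 <= s n) -> (forall n, s n.+1 <= s n) -> exists l : C R, s @ \oo --> l.
Proof.
move=> s0 sS; pose u n := complex.Re (s n).
have [l ul] : exists l : R, u @ \oo --> l.
  have ui : nonincreasing_seq u.
    by apply/nonincreasing_seqP => n; have := sS n; rewrite lecE => /andP[].
  exists (limn u); apply: nonincreasing_is_cvgn => //.
  by exists 0 => _ [n _ <-]; have := s0 n; rewrite lecE => /andP[].
exists (Complex l 0); apply: cvgC_ReIm => //=.
under eq_fun => n do rewrite ger0_Im //.
exact: cvg_cst.
Qed.

Section WalkOperator.
Variables (R : realType) (k r : nat) (G : multigraph k).
Variables (T : topologicalGroupType) (t : 'I_k -> T) (mu : probability (borel T) R).
Hypothesis cT : compact [set: T].
Hypothesis hmu : haar mu.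
Hypothesis reg : graph_regular G r.
Hypothesis r0 : (0 < r)%N.
Implicit Types f h : 'I_k -> T -> C R.

Local Notation CI := (integral_complex mu).

Definition walk_operator f : 'I_k -> T -> C R := fun i g =>
  \sum_(e : edge G | source e == i) r%:R^-1 * f (target e) (t i * g)%g.

Local Notation P := walk_operator.

Let r0' : r%:R != 0 :> C R. Proof. by rewrite pnatr_eq0 -lt0n. Qed.

Lemma sum_out_cst i (a : C R) : \sum_(e : edge G | source e == i) r%:R^-1 * a = a.
Proof. by rewrite sumr_const (card_source i reg) -[LHS]mulr_natl mulrA divff // mul1r. Qed.

(** Equal in-degrees make the transition matrix doubly stochastic, so the uniform distribution on
    the vertices is preserved. *)
Lemma sum_target (a : 'I_k -> C R) :
  \sum_i \sum_(e : edge G | source e == i) r%:R^-1 * a (target e) = \sum_j a j.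
Proof.
transitivity (\sum_(e : edge G) r%:R^-1 * a (target e)).
  by rewrite [RHS](partition_big (@source k G) xpredT).
rewrite (partition_big (@target k G) xpredT) //=; apply: eq_bigr => j _.
rewrite (eq_bigr (fun=> r%:R^-1 * a j)) => [|e /eqP -> //].
by rewrite sumr_const (card_target j reg) -[LHS]mulr_natl mulrA divff // mul1r.
Qed.

Lemma walk_operator_kfam M W f : 0 <= M -> (forall i, kfam M W (f i)) ->
  forall i, kfam M W (P f i).
Proof.
move=> M0 kf i; apply: (kfam_sum M0) => [e _|]; first exact: kfam_translate.
by rewrite ger0_norm ?invr_ge0 // -[leRHS](sum_out_cst i) ler_sum // => e _; rewrite mulr1.
Qed.

Lemma walk_operator_continuous f : (forall i, continuous (f i)) -> forall i, continuous (P f i).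
Proof.
move=> cf i x; apply: cvg_sum_seq => e _; apply: cvgMr.
exact: (continuous_comp_mulgl (t := t i) (cf (target e))).
Qed.

Lemma walk_operator_contract f h (d : C R) : 0 <= d ->
  (forall i g, `|f i g - h i g| <= d) -> forall i g, `|P f i g - P h i g| <= d.
Proof.
move=> d0 fh i g; rewrite /walk_operator -sumrB; apply: le_trans (ler_norm_sum _ _ _) _.
rewrite -[leRHS](sum_out_cst i); apply: ler_sum => e _.
by rewrite -mulrBr normrM ger0_norm ?invr_ge0 // ler_wpM2l ?invr_ge0.
Qed.

Lemma iter_walk_operator_contract f h (d : C R) n : 0 <= d ->
  (forall i g, `|f i g - h i g| <= d) -> forall i g, `|iter n P f i g - iter n P h i g| <= d.
Proof.
by move=> d0 fh; elim: n => [//|n IH] /=; exact: walk_operator_contract.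
Qed.

Lemma iter_walk_operator_continuous f n : (forall i, continuous (f i)) ->
  forall i, continuous (iter n P f i).
Proof. by move=> cf; elim: n => [//|n IH] /=; exact: walk_operator_continuous. Qed.

Lemma iter_walk_operator_kfam M W f n : 0 <= M -> (forall i, kfam M W (f i)) ->
  forall i, kfam M W (iter n P f i).
Proof. by move=> M0 kf; elim: n => [//|n IH] /=; exact: walk_operator_kfam. Qed.

Definition total_integral f := \sum_i CI (f i).

Lemma total_integral_walk_operator f : (forall i, continuous (f i)) ->
  total_integral (P f) = total_integral f.
Proof.
move=> cf; rewrite /total_integral -[RHS]sum_target; apply: eq_bigr => i _.
have ct (e : edge G) : continuous (fun g => f (target e) (t i * g)%g).
  exact: (continuous_comp_mulgl (t := t i) (cf (target e))).
rewrite /walk_operator /= (cint_sum mu cT); last by move=> e x; apply: cvgMr; exact: ct.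
by apply: eq_bigr => e _; rewrite (cintZ mu cT _ (ct e)) (cint_mulgl cT hmu _ (cf _)).
Qed.

Definition energy f := \sum_i CI (fun g => `|f i g| ^+ 2).

Definition dissipation f :=
  \sum_i \sum_(e : edge G | source e == i) \sum_(e' : edge G | source e' == i)
    CI (fun g => `|f (target e) (t i * g)%g - f (target e') (t i * g)%g| ^+ 2).

(** The variance identity over the edges out of each vertex, integrated. Invariance of [mu] removes
    the factor [t i], and [sum_target] redistributes the energy among the vertices. *)
Lemma energy_walk_operator f : (forall i, continuous (f i)) ->
  energy f - energy (P f) = (2 * r%:R ^+ 2)^-1 * dissipation f.
Proof.
move=> cf; rewrite /energy -sum_target -sumrB /dissipation mulr_sumr.
apply: eq_bigr => i _.
have ct (e : edge G) : continuous (fun g => f (target e) (t i * g)%g).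
  exact: (continuous_comp_mulgl (t := t i) (cf (target e))).
have cs (e : edge G) := continuous_normsq (ct e).
have cd (e e' : edge G) :
    continuous (fun g => `|f (target e) (t i * g)%g - f (target e') (t i * g)%g| ^+ 2).
  by apply: continuous_normsq => x; apply: cvgB; exact: ct.
have cP := continuous_normsq (walk_operator_continuous cf (i := i)).
have -> : \sum_(e : edge G | source e == i) \sum_(e' : edge G | source e' == i)
    CI (fun g => `|f (target e) (t i * g)%g - f (target e') (t i * g)%g| ^+ 2) =
  CI (fun g => (2 * r%:R) * (\sum_(e : edge G | source e == i) `|f (target e) (t i * g)%g| ^+ 2)
     + (- (2 * r%:R ^+ 2)) * `|P f i g| ^+ 2).
  transitivity (CI (fun g => \sum_(e : edge G | source e == i) \sum_(e' : edge G | source e' == i)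
      `|f (target e) (t i * g)%g - f (target e') (t i * g)%g| ^+ 2)).
    rewrite (cint_sum mu cT); last by move=> e x; apply: cvg_sum_seq => e' _; exact: cd.
    by apply: eq_bigr => e _; rewrite (cint_sum mu cT); last by move=> e' x; exact: cd.
  congr (CI _); apply/funext => g; rewrite variance_identity.
  rewrite (card_source i reg) /walk_operator -mulr_sumr normrM exprMn ger0_norm ?invr_ge0 //.
  by field.
have cS : continuous (fun g => \sum_(e : edge G | source e == i) `|f (target e) (t i * g)%g| ^+ 2).
  by move=> x; apply: cvg_sum_seq => e _; exact: cs.
have cS' : continuous (fun g => (2 * r%:R) *
    \sum_(e : edge G | source e == i) `|f (target e) (t i * g)%g| ^+ 2).
  by move=> x; apply: cvgMr; exact: cS.
have cP' : continuous (fun g => (- (2 * r%:R ^+ 2)) * `|P f i g| ^+ 2).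
  by move=> x; apply: cvgMr; exact: cP.
rewrite (cintD mu cT cS' cP') (cintZ mu cT _ cS) (cintZ mu cT _ cP).
rewrite (cint_sum mu cT); last by move=> e x; exact: cs.
have -> : \sum_(e : edge G | source e == i) CI (fun g => `|f (target e) (t i * g)%g| ^+ 2) =
    \sum_(e : edge G | source e == i) CI (fun g => `|f (target e) g| ^+ 2).
  by apply: eq_bigr => e _; rewrite (cint_mulgl cT hmu _ (continuous_normsq (cf (target e)))).
by rewrite -mulr_sumr; field.
Qed.

Lemma dissipation_term_ge0 f i (e e' : edge G) : (forall i, continuous (f i)) ->
  0 <= CI (fun g => `|f (target e) (t i * g)%g - f (target e') (t i * g)%g| ^+ 2).
Proof.
move=> cf; apply: (cint_ge0 cT hmu); last by move=> x; rewrite exprn_ge0.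
by apply: continuous_normsq => x; apply: cvgB;
  apply: (continuous_comp_mulgl (t := t i) (cf _)).
Qed.

Lemma energy_ge0 f : (forall i, continuous (f i)) -> 0 <= energy f.
Proof.
move=> cf; apply: sumr_ge0 => i _; apply: (cint_ge0 cT hmu); last by move=> x; rewrite exprn_ge0.
exact: continuous_normsq.
Qed.

Lemma energy_walk_operator_le f : (forall i, continuous (f i)) -> energy (P f) <= energy f.
Proof.
move=> cf; rewrite -subr_ge0 energy_walk_operator // mulr_ge0 ?invr_ge0 ?mulr_ge0 ?exprn_ge0 //.
by do 3! [apply: sumr_ge0 => ? _]; exact: dissipation_term_ge0.
Qed.

(** Without loss of energy every term of the dissipation vanishes, and a nonnegative continuous
    function with integral zero is zero. *)
Lemma energy_walk_operator_eq f : (forall i, continuous (f i)) -> energy (P f) = energy f ->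
  forall e e' : edge G, source e = source e' -> f (target e) = f (target e').
Proof.
move=> cf Ef e e' see'; have D0 : dissipation f = 0.
  have := energy_walk_operator cf; rewrite Ef subrr => /esym/eqP.
  rewrite mulf_eq0 invr_eq0 mulf_eq0 expf_eq0 /= (negPf r0') pnatr_eq0 /=.
  by move/eqP.
have : CI (fun g => `|f (target e) (t (source e) * g)%g - f (target e') (t (source e) * g)%g| ^+ 2)
    = 0.
  move: D0 => /psumr_eq0P D1.
  have /psumr_eq0P D2 := D1 (fun i _ => sumr_ge0 _ (fun e _ => sumr_ge0 _
     (fun e' _ => dissipation_term_ge0 i e e' cf))) (source e) isT.
  have /psumr_eq0P D3 := D2 (fun e1 _ => sumr_ge0 _
     (fun e' _ => dissipation_term_ge0 (source e) e1 e' cf)) e (eqxx _).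
  apply: (D3 (fun e1 _ => dissipation_term_ge0 (source e) e e1 cf)).
  by rewrite see'.
move=> CI0; apply/funext => x; apply/eqP; rewrite -subr_eq0.
apply/negPn/negP => nz; move: CI0; apply/eqP; rewrite gt_eqF //.
apply: (cint_gt0 cT hmu (g0 := ((t (source e))^-1 * x)%g)).
- apply: continuous_normsq => y; apply: cvgB.
    exact: (continuous_comp_mulgl (t := t (source e)) (cf (target e))).
  exact: (continuous_comp_mulgl (t := t (source e)) (cf (target e'))).
- by move=> y; rewrite exprn_ge0.
- by rewrite mulVKg exprn_gt0 // normr_gt0.
Qed.

End WalkOperator.

(** * Convergence of the iterates of the walk operator *)

Section WalkLimit.
Variables (R : realType) (k r : nat) (G : multigraph k).
Variables (T : topologicalGroupType) (t : 'I_k -> T) (mu : probability (borel T) R).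
Hypothesis cT : compact [set: T].
Hypothesis hmu : haar mu.
Hypothesis reg : graph_regular G r.
Hypothesis conn : graph_connected G.
Hypothesis nb : nonbipartite G.
Hypothesis genT : closed_subgroup_generated (range t) = [set: T].
Hypothesis noC : forall rho : T -> C R, unitary_character rho -> (exists x, rho x != 1) ->
     ~ in_one_coset (range t) (character_kernel rho).

Local Notation CI := (integral_complex mu).
Local Notation P := (@walk_operator R k r G T t).

Let r0 : (0 < r)%N := regular_degree_gt0 conn nb reg.

(* Once the energy stops decreasing, the operator acts as translation by any [t i]. *)
Lemma constant_energy_eq0 (h : 'I_k -> T -> C R) : (forall i, continuous (h i)) ->
  (forall n, energy mu (iter n P h) = energy mu h) -> total_integral mu h = 0 ->
  forall i x, h i x = 0.
Proof.
move=> ch hE h0; have [k0 _] := conn; pose i0 : 'I_k := Ordinal k0.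
have cn n := @iter_walk_operator_continuous R k r G T t h n ch.
(* Equal energies of consecutive iterates make the [n]-th one agree at all out-neighbours of a
   vertex, and the double cover spreads this to all vertices. *)
have vi n i : iter n P h i = iter n P h i0.
  apply: (nonbipartite_const conn nb) => e e'.
  apply: (energy_walk_operator_eq cT hmu reg r0 (cn n)).
  exact: etrans (hE n.+1) (esym (hE n)).
have step n i x : iter n P h i0 (t i * x)%g = iter n.+1 P h i0 x.
  rewrite -(vi n.+1 i) iterS /walk_operator.
  under eq_bigr do rewrite vi.
  by rewrite (sum_out_cst reg r0 i).
have iterE n x : iter n P h i0 x = h i0 (t i0 ^+ n * x)%g.
  elim: n x => [|n IH] x; first by rewrite expg0 mul1g.
  by rewrite -(step n i0) IH expgSr mulgA.
(* On the translates of [h i0] by powers of [t i0], every [t i] acts as [t i0] does; [psiS] carries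
   this over to the eigenfunction. *)
have shift i n x : h i0 (t i0 ^+ n * (t i * x))%g = h i0 (t i0 ^+ n.+1 * x)%g.
  by rewrite -!iterE step.
have CI0 : CI (h i0) = 0.
  move: h0; rewrite /total_integral (eq_bigr (fun=> CI (h i0))) => [|i _].
    rewrite sumr_const card_ord -[LHS]mulr_natl => /eqP.
    by rewrite mulf_eq0 pnatr_eq0 (gtn_eqF k0) => /eqP.
  by have -> : h i = h i0 := vi 0%N i.
suff z x : h i0 x = 0 by move=> i x; have -> : h i = h i0 := vi 0%N i.
apply: contrapT => hx.
have [|psi [l [[cpsi [y py] l1 eig] [psi0 psiS]]]] :=
  translation_eigenfunction cT hmu (t i0) (ch i0); first by exists x; apply/eqP.
have pconst : forall x y, psi x = psi y.
  apply: (eigenfunction_const genT noC i0 cpsi l1) => i z.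
  by rewrite -eig; apply: psiS => a w; rewrite !shift.
move/eqP: py; apply; rewrite -(psi0 CI0) -(cint_cst mu (psi y)).
by congr (CI _); apply/funext => z; exact: pconst.
Qed.

Lemma walk_operator_cvg0 (f : 'I_k -> T -> C R) : (forall i, continuous (f i)) ->
  total_integral mu f = 0 -> forall i x, (fun N => iter N P f i x) @ \oo --> (0 : C R).
Proof.
move=> cf f0 i x; apply: ultra_cvgP => U UU oU.
have [M [W [M0 mW kf]]] := kfam_finite cT cf.
have kn n j : kfam M W (iter n P f j) := iter_walk_operator_kfam t reg r0 n M0 kf j.
have /boolp.choice[h hP] : forall j, exists h, kfam M W h /\
    forall e : C R, 0 < e -> \forall n \near U, forall y, `|h y - iter n P f j y| < e.
  by move=> j; apply: (kfam_ultralimit cT UU mW) => n.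
have kh j : kfam M W (h j) by have [] := hP j.
have ch j := kfam_continuous mW (kh j).
have cn n j := kfam_continuous mW (kn n j).
have hU (e : C R) : 0 < e -> \forall n \near U, forall j y, `|h j y - iter n P f j y| <= e.
  move=> e0; apply: filter_forall => j; have [_ /(_ e e0)] := hP j.
  by apply: filterS => n hn y; exact/ltW/hn.
have tot n : total_integral mu (iter n P f) = 0.
  elim: n => [//|n IH]; rewrite iterS.
  by rewrite (total_integral_walk_operator t cT hmu reg r0 (cn n)).
have h0 : total_integral mu h = 0.
  have c1 : (fun n => total_integral mu (iter n P f)) @ U --> total_integral mu h.
    apply: cvg_sum_seq => j _; apply: (cint_uniform_cvg cT _ (fun n => cn n j) (ch j)) => e e0.
    by apply: filterS (hU e e0) => n hn y; exact: hn.
  have c2 : (fun n => total_integral mu (iter n P f)) @ U --> (0 : C R).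
    by under eq_fun do rewrite tot; exact: cvg_cst.
  exact: cvg_unique c1 c2.
have [s hs] : exists s : C R, (fun n => energy mu (iter n P f)) @ \oo --> s.
  apply: nonincreasing_ge0_cvgC => n; first exact: (energy_ge0 cT hmu (cn n)).
  exact: (energy_walk_operator_le t cT hmu reg r0 (cn n)).
(* The energy of [iter n P h] is the limit along [U] of the energies of the iterates of [f], shifted
   by [n], and these tend to [s]. *)
have hE n : energy mu (iter n P h) = s.
  have c1 : (fun N => energy mu (iter n P (iter N P f))) @ U --> energy mu (iter n P h).
    apply: cvg_sum_seq => j _.
    have kN N : kfam M W (iter n P (iter N P f) j) by rewrite -iterD; exact: kn.
    have kH : kfam M W (iter n P h j) := iter_walk_operator_kfam t reg r0 n M0 kh j.
    have cN N := kfam_continuous mW (kN N).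
    have cH := kfam_continuous mW kH.
    apply: (cint_uniform_cvg cT _ (fun N => continuous_normsq (cN N)) (continuous_normsq cH)).
    (* A difference of squared norms is at most [d] times the sum of the norms, which is below
       [2 * (M + 1)]. *)
    move=> e e0; pose d := e / (2 * (M + 1)).
    have M1 : 0 < M + 1 by rewrite ltr_wpDl.
    have d0 : 0 < d by rewrite divr_gt0 // mulr_gt0.
    apply: filterS (hU d d0) => N hN y.
    have ab := iter_walk_operator_contract t reg r0 n (ltW d0) hN j y.
    have [bH _] := kH; have [bN _] := kN N.
    rewrite subr_sqr normrM.
    have n2 : `| `|iter n P h j y| + `|iter n P (iter N P f) j y| | <= 2 * (M + 1).
      rewrite ger0_norm ?addr_ge0 // (_ : 2 * (M + 1) = (M + 1) + (M + 1)); last by ring.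
      apply: lerD; [apply: le_trans (bH y) _|apply: le_trans (bN y) _]; by rewrite lerDl.
    have -> : e = d * (2 * (M + 1)) by rewrite /d; field; rewrite lt0r_neq0.
    apply: ler_pM => //; apply: le_trans ab; exact: ler_dist_dist.
  have c2 : (fun N => energy mu (iter n P (iter N P f))) @ U --> s.
    apply/cvgrPdist_lt => e e0; have /cvgrPdist_lt /(_ e e0) [m _ hm] := hs.
    apply: oU; exists m => // N /= mN; rewrite -iterD; apply: hm.
    exact: leq_trans mN (leq_addl _ _).
  exact: cvg_unique c1 c2.
have hz := constant_energy_eq0 ch (fun n => etrans (hE n) (esym (hE 0%N))) h0.
apply/cvgrPdist_lt => e e0; have [_ /(_ e e0)] := hP i.
by apply: filterS => n /(_ x); rewrite hz.
Qed.

Lemma iter_walk_operatorB (f : 'I_k -> T -> C R) (a : C R) n i x :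
  iter n P (fun i x => f i x - a) i x = iter n P f i x - a.
Proof.
elim: n i x => [//|n IH] i x; rewrite !iterS /walk_operator.
under eq_bigr do rewrite IH mulrBr.
by rewrite sumrB (sum_out_cst reg r0 i).
Qed.

(** The operator fixes constants, so subtracting the mean reduces the claim to total integral
    zero. *)
Lemma walk_operator_cvg (f : 'I_k -> T -> C R) : (forall i, continuous (f i)) ->
  forall i x, (fun N => iter N P f i x) @ \oo --> total_integral mu f / k%:R.
Proof.
move=> cf i x; pose a := total_integral mu f / k%:R.
have [k0 _] := conn; have k0' : k%:R != 0 :> C R by rewrite pnatr_eq0 -lt0n.
have ca : continuous (fun _ : T => a) by move=> y; exact: cvg_cst.
have cfa j : continuous (fun y => f j y - a) by move=> y; apply: cvgB; [exact: cf|exact: ca].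
have tot : total_integral mu (fun j y => f j y - a) = 0.
  have E j : CI (fun y => f j y - a) = CI (f j) - a.
    have ca' : continuous (fun _ : T => - a) by move=> y; exact: cvg_cst.
    by rewrite (cintD mu cT (cf j) ca') cint_cst.
  rewrite /total_integral; under eq_bigr do rewrite E.
  by rewrite sumrB sumr_const card_ord -[X in _ - X]mulr_natl /a mulrC divfK // subrr.
have := walk_operator_cvg0 cfa tot i x.
under eq_fun do rewrite iter_walk_operatorB.
move=> h; rewrite -/a -[a]add0r.
have -> : (fun N => iter N P f i x) = (fun N => (iter N P f i x - a) + a).
  by apply/funext => N; rewrite subrK.
by apply: cvgD h _; exact: cvg_cst.
Qed.

End WalkLimit.

(** * Closed walks *)

Lemma sum_tupleS (V : nmodType) (A : finType) (n : nat) (p : pred (seq A)) (F : seq A -> V) :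
  \sum_(c : n.+1.-tuple A | p c) F c =
  \sum_(a : A) \sum_(c : n.-tuple A | p (a :: c)) F (a :: c).
Proof.
rewrite pair_big_dep /=.
rewrite (reindex (fun ac : A * n.-tuple A => [tuple of ac.1 :: ac.2])) /=.
  by apply: eq_bigl => -[a c].
exists (fun c : n.+1.-tuple A => (thead c, [tuple of behead c])) => [[a c] _|c _] /=.
  by congr pair; apply: val_inj.
by rewrite [RHS]tuple_eta; apply: val_inj.
Qed.

Section Walks.
Variables (k : nat) (G : multigraph k).

Fixpoint is_walk (i : 'I_k) (c : seq (edge G)) : bool :=
  if c is e :: c' then (source e == i) && is_walk (target e) c' else true.

Definition walk_end (i : 'I_k) (c : seq (edge G)) : 'I_k := last i [seq target e | e <- c].

(** In a cycle the appended [e0] is the first edge again, and only its source, the basepoint,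
    enters. *)
Lemma path_is_walk (e e0 : edge G) c :
  path [rel e f | target e == source f] e (rcons c e0) =
  is_walk (target e) c && (walk_end (target e) c == source e0).
Proof.
elim: c e => [|e' c IH] e /=; first by rewrite andbT.
by rewrite IH eq_sym andbA.
Qed.

(** Only the source of the first edge contributes on the right. The length is positive because the
    empty walk would count once on the left but once per vertex on the right. *)
Lemma closed_walkE n (c : n.+1.-tuple (edge G)) (V : nmodType) (x : V) :
  (if c \in closed_walks G n.+1 then x else 0) =
  \sum_i (if is_walk i c && (walk_end i c == i) then x else 0).
Proof.
rewrite inE; case/tupleP: c => e c; rewrite [cycle _ _]path_is_walk.
rewrite (bigD1 (source e)) //= eqxx /=.
rewrite big1 ?addr0 // => i; rewrite eq_sym => /negPf -> //.
Qed.

Lemma sum_closed_walks (V : nmodType) n (F : seq (edge G) -> V) :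
  \sum_(c in closed_walks G n.+1) F c =
  \sum_i \sum_(c : n.+1.-tuple (edge G) | is_walk i c && (walk_end i c == i)) F c.
Proof.
rewrite big_mkcond /=; under eq_bigr do rewrite closed_walkE.
by rewrite exchange_big /=; apply: eq_bigr => i _; rewrite -big_mkcond.
Qed.

Variables (R : realType) (r : nat) (T : topologicalGroupType) (t : 'I_k -> T).
Local Notation P := (@walk_operator R k r G T t).

(** The operator applies [t i] before passing to the next vertex, so later vertices multiply on the
    left, in the order of [walk_product]. *)
Lemma iter_walk_operatorE (f : 'I_k -> T -> C R) n i x :
  iter n P f i x = r%:R ^- n *
    \sum_(c : n.-tuple (edge G) | is_walk i c)
      f (walk_end i c) (foldl (fun g w => (t w * g)%g) x (walk_vertices c)).
Proof.
elim: n i x => [|n IH] i x.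
  rewrite /= expr0 invr1 mul1r (big_pred1 [tuple]) // => c.
  by rewrite tuple0 /= eqxx.
rewrite iterS {1}/walk_operator.
rewrite (sum_tupleS n (is_walk i) (fun c =>
  f (walk_end i c) (foldl (fun g w => (t w * g)%g) x (walk_vertices c)))).
rewrite mulr_sumr big_mkcond /=; apply: eq_bigr => e _.
case: ifP => [/eqP se|_]; last by rewrite big_pred0_eq mulr0.
rewrite IH mulrA exprS invfM; congr (_ * _).
by apply: eq_bigr => c _; rewrite se.
Qed.

End Walks.

(** * Equidistribution over closed walks *)

Section Equidistribution.
Variables (R : realType) (k r : nat) (G : multigraph k).
Variables (T : topologicalGroupType) (t : 'I_k -> T) (mu : probability (borel T) R).
Hypothesis cT : compact [set: T].
Hypothesis hmu : haar mu.
Hypothesis reg : graph_regular G r.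
Hypothesis conn : graph_connected G.
Hypothesis nb : nonbipartite G.
Hypothesis genT : closed_subgroup_generated (range t) = [set: T].
Hypothesis noC : forall rho : T -> C R, unitary_character rho -> (exists x, rho x != 1) ->
     ~ in_one_coset (range t) (character_kernel rho).

Lemma closed_walks_cvg (F : T -> C R) : continuous F ->
  (fun N => r%:R ^- N * \sum_(c in closed_walks G N) F (walk_product t c)) @ \oo -->
    integral_complex mu F.
Proof.
move=> cF; have [k0 _] := conn; have k0' : k%:R != 0 :> C R by rewrite pnatr_eq0 -lt0n.
(* Concentrating [F] at the vertex [i] selects, among the walks from [i], those that return to it.
   Each of the k basepoints then contributes 1/k of the integral in the limit. *)
pose f (i j : 'I_k) (x : T) : C R := if j == i then F x else 0.
have cf i j : continuous (f i j) by rewrite /f; case: (j == i); [exact: cF|move=> x; exact: cvg_cst].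
have tot i : total_integral mu (f i) = integral_complex mu F.
  rewrite /total_integral (bigD1 i isT) /= big1 => [|j /negPf ji].
    by rewrite addr0 /f eqxx.
  by rewrite /f ji cint_cst.
have lim : (fun N => \sum_i iter N (@walk_operator R k r G T t) (f i) i 1%g) @ \oo -->
    \sum_(i < k) total_integral mu (f i) / k%:R.
  apply: cvg_sum_seq => i _.
  exact: (walk_operator_cvg cT hmu reg conn nb genT noC (cf i)).
have limE : \sum_(i < k) total_integral mu (f i) / k%:R = integral_complex mu F.
  under eq_bigr do rewrite tot.
  by rewrite sumr_const card_ord -[LHS]mulr_natl mulrC divfK.
have E N : \sum_i iter N.+1 (@walk_operator R k r G T t) (f i) i 1%g =
    r%:R ^- N.+1 * \sum_(c in closed_walks G N.+1) F (walk_product t c).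
  rewrite (sum_closed_walks N (fun c => F (walk_product t c))) mulr_sumr.
  apply: eq_bigr => i _; rewrite iter_walk_operatorE; congr (_ * _).
  by rewrite big_mkcondr; apply: eq_bigr => c _.
rewrite limE in lim; apply: cvg_trans lim; apply: near_eq_cvg.
(* The sequences are compared from N = 1 on, where every walk has a basepoint. *)
by exists 1%N => // -[//|N] _; exact: E N.
Qed.

End Equidistribution.

Theorem theorem9p1 (R : realType) (k r : nat) (G : multigraph k)
    (T : topologicalGroupType) (t : 'I_k -> T) (mu : probability (borel T) R) :
  graph_connected G -> graph_regular G r -> nonbipartite G ->
  compact [set: T] ->
  closed_subgroup_generated (range t) = [set: T] ->
  (forall rho : T -> C R, unitary_character rho -> (exists x, rho x != 1) ->
     ~ in_one_coset (range t) (character_kernel rho)) ->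
  haar mu ->
  forall F : T -> C R, continuous F ->
    (fun N => (#|closed_walks G N|%:R)^-1 *
              \sum_(c in closed_walks G N) F (walk_product t c))
      @ \oo --> integral_complex mu F.
Proof.
move=> conn reg nb cT genT noC hmu F cF.
have r0 : r%:R != 0 :> C R by rewrite pnatr_eq0 -lt0n (regular_degree_gt0 conn nb reg).
have limF := closed_walks_cvg cT hmu reg conn nb genT noC cF.
(* The case F = 1 shows that the number of closed walks divided by [r ^ N] tends to 1, so either
   normalisation gives the same limit. *)
have c1 : continuous (fun _ : T => 1 : C R) by move=> x; exact: cvg_cst.
have lim1 := closed_walks_cvg cT hmu reg conn nb genT noC c1.
rewrite cint_cst in lim1.
have -> : (fun N => (#|closed_walks G N|%:R)^-1 *
    \sum_(c in closed_walks G N) F (walk_product t c)) =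
  (fun N => (r%:R ^- N * \sum_(c in closed_walks G N) 1)^-1 *
    (r%:R ^- N * \sum_(c in closed_walks G N) F (walk_product t c))).
  apply/funext => N; rewrite sumr_const invfM invrK mulrACA mulfV ?mul1r //.
  exact: expf_neq0.
have H := cvgM (cvgV (oner_neq0 _) lim1) limF; rewrite invr1 mul1r in H.
exact: H.
Qed.
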